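(* Fix $n \geq 0$ and let $B \subseteq \omega$ be a set that is not $\emptyset^{(n)}$-computable. Then for every set $A \subseteq \omega$ there is an infinite set $H$ with $H \subseteq A$ or $H \subseteq \omega \setminus A$ such that $B$ is not $H^{(n)}$-computable.
   Context: $X^{(n)}$ denotes the $n$-th Turing jump of $X$ (with $X^{(0)}=X$). *)

(* Defs.v *)
From Stdlib Require Import Arith List Cantor.
Import ListNotations.

(* Syntax of oracle mu-recursive programs, acting on argument lists
   (missing arguments default to 0). *)
Inductive prog : Type :=
| PZero : prog
| PSucc : prog
| PProj : nat -> prog
| POracle : prog
| PComp : prog -> list prog -> prog
| PPrec : prog -> prog -> prog
| PMu : prog -> prog.

Inductive ev (X : nat -> Prop) : prog -> list nat -> nat -> Prop :=
| evZero v : ev X PZero v 0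
| evSucc v : ev X PSucc v (S (hd 0 v))
| evProj i v : ev X (PProj i) v (nth i v 0)
| evOracle1 v : X (hd 0 v) -> ev X POracle v 1
| evOracle0 v : ~ X (hd 0 v) -> ev X POracle v 0
| evComp f gs v ys z : evl X gs v ys -> ev X f ys z -> ev X (PComp f gs) v z
| evPrec0 f g v z : hd 0 v = 0 -> ev X f (tl v) z -> ev X (PPrec f g) v z
| evPrecS f g v n y z : hd 0 v = S n -> ev X (PPrec f g) (n :: tl v) y ->
    ev X g (n :: y :: tl v) z -> ev X (PPrec f g) v z
| evMu f v n : ev X f (n :: v) 0 ->
    (forall m, m < n -> exists k, ev X f (m :: v) (S k)) -> ev X (PMu f) v n
with evl (X : nat -> Prop) : list prog -> list nat -> list nat -> Prop :=
| evlNil v : evl X [] v []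
| evlCons g gs v y ys : ev X g v y -> evl X gs v ys -> evl X (g :: gs) v (y :: ys).

(* Goedel numbering: a (surjective, effective) decoding nat -> prog via
   Cantor pairing. *)
Fixpoint dec (k e : nat) : prog :=
  match k with
  | 0 => PZero
  | S k' =>
    let (t, r) := of_nat e in
    match t with
    | 0 => PZero
    | 1 => PSucc
    | 2 => PProj r
    | 3 => POracle
    | 4 => let (a, b) := of_nat r in PComp (dec k' a) (decl k' b)
    | 5 => let (a, b) := of_nat r in PPrec (dec k' a) (dec k' b)
    | 6 => PMu (dec k' r)
    | _ => PZero
    end
  end
with decl (k e : nat) : list prog :=
  match k with
  | 0 => []
  | S k' =>
    match e with
    | 0 => []
    | S m => let (c, d) := of_nat m in dec k' c :: decl k' d
    end
  end.

Definition decode (e : nat) : prog := dec (S e) e.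

Definition computable_in (B X : nat -> Prop) : Prop :=
  exists p : prog, forall x : nat,
    (B x -> ev X p [x] 1) /\ (~ B x -> ev X p [x] 0).

Definition jump (X : nat -> Prop) : nat -> Prop :=
  fun e => exists z, ev X (decode e) [e] z.

Definition njump (n : nat) (X : nat -> Prop) : nat -> Prop :=
  Nat.iter n jump X.

Definition emptyset : nat -> Prop := fun _ => False.

Definition infinite (H : nat -> Prop) : Prop :=
  forall m, exists x, m <= x /\ H x.

(* Main.v *)
Require Import Defs.
From Stdlib Require Import Arith List Cantor Lia Classical ClassicalEpsilon
  FunctionalExtensionality PropExtensionality.
Import ListNotations.

(** If [B] is not [0^(n)]-computable, then [B] or its complement is not
    Sigma_(n+1); call that set [B] again, and look for [H] with [B] not
    Sigma_(n+1)(H).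

    Take Scott sets [M_0, ..., M_n], with [M_k] coded by a set low over [0^(k)] for
    [k < n], and with [B] not c.e. in any member of [M_n].  By recursion on [k], let
    [P_0] be the class of infinite sets, [u_k] an ultrafilter on [M_k] contained in
    [P_k], and [P_(k+1)] the class of sets that belong to every upward closed class
    which is open, c.e. in [M_k], and contains [u_k].  Compactness and the Scott
    property make [P_(k+1)] partition regular; its complexity is low enough for
    [u_(k+1)] to be found in [M_(k+2)].

    [H] is built by Mathias forcing with conditions [(s, X)], where [X] is in [M_n] and
    the intersection of [X] with the chosen side ([A] or its complement) is in [P_n].
    For a Sigma_(m+1) formula [exists x, ~ psi_x] ([m > 0]) and a string [s] consider the open class
    of those [Y] such that some extension [t] of [s] by elements of [Y] fails to have
    [u_(m-1)] included in the class of [psi_x] and [t], for some [x].  If the class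
    includes [u_m], it includes [P_(m+1)] and the formula can be forced; otherwise a member
    of [u_m] outside of it is a reservoir forcing the negation.  Thus formulas of level at
    most [n] are decided, and the class attached to one of level [n+1] is c.e. in [M_n].

    At level [n+1] both sides are played against each other: if a condition for [A] cannot
    be extended to satisfy a requirement, then asking whether each splitting of the
    reservoir meets one of two such classes is a c.e. question in [M_n], which cannot
    define [B]; so the conditions for the complement of [A] below that reservoir can
    satisfy all requirements. *)

(** * Programs and total functions on argument lists *)

Section EvInd.
Variable X : nat -> Prop.
Variable P : prog -> list nat -> nat -> Prop.
Variable Q : list prog -> list nat -> list nat -> Prop.
Hypothesis HZ : forall v, P PZero v 0.
Hypothesis HS : forall v, P PSucc v (S (hd 0 v)).
Hypothesis HP : forall i v, P (PProj i) v (nth i v 0).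
Hypothesis HO1 : forall v, X (hd 0 v) -> P POracle v 1.
Hypothesis HO0 : forall v, ~ X (hd 0 v) -> P POracle v 0.
Hypothesis HC : forall f gs v ys z, evl X gs v ys -> Q gs v ys ->
  ev X f ys z -> P f ys z -> P (PComp f gs) v z.
Hypothesis HR0 : forall f g v z, hd 0 v = 0 -> ev X f (tl v) z -> P f (tl v) z ->
  P (PPrec f g) v z.
Hypothesis HRS : forall f g v n y z, hd 0 v = S n ->
  ev X (PPrec f g) (n :: tl v) y -> P (PPrec f g) (n :: tl v) y ->
  ev X g (n :: y :: tl v) z -> P g (n :: y :: tl v) z -> P (PPrec f g) v z.
Hypothesis HM : forall f v n, ev X f (n :: v) 0 -> P f (n :: v) 0 ->
  (forall m, m < n -> exists k, ev X f (m :: v) (S k) /\ P f (m :: v) (S k)) ->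
  P (PMu f) v n.
Hypothesis HN : forall v, Q [] v [].
Hypothesis HK : forall g gs v y ys, ev X g v y -> P g v y -> evl X gs v ys ->
  Q gs v ys -> Q (g :: gs) v (y :: ys).

(* The generated schemes give no induction hypothesis under the [exists] of [evMu]. *)
Fixpoint ev_nested_ind p v z (H : ev X p v z) {struct H} : P p v z :=
  match H with
  | evZero _ v => HZ v
  | evSucc _ v => HS v
  | evProj _ i v => HP i v
  | evOracle1 _ v h => HO1 v h
  | evOracle0 _ v h => HO0 v h
  | evComp _ f gs v ys z h1 h2 =>
      HC f gs v ys z h1 (evl_nested_ind _ _ _ h1) h2 (ev_nested_ind _ _ _ h2)
  | evPrec0 _ f g v z e h => HR0 f g v z e h (ev_nested_ind _ _ _ h)
  | evPrecS _ f g v n y z e h1 h2 =>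
      HRS f g v n y z e h1 (ev_nested_ind _ _ _ h1) h2 (ev_nested_ind _ _ _ h2)
  | evMu _ f v n h hm => HM f v n h (ev_nested_ind _ _ _ h)
      (fun m lm => match hm m lm with
        | ex_intro _ k hk => ex_intro _ k (conj hk (ev_nested_ind _ _ _ hk)) end)
  end
with evl_nested_ind gs v ys (H : evl X gs v ys) {struct H} : Q gs v ys :=
  match H with
  | evlNil _ v => HN v
  | evlCons _ g gs v y ys h1 h2 =>
      HK g gs v y ys h1 (ev_nested_ind _ _ _ h1) h2 (evl_nested_ind _ _ _ h2)
  end.
End EvInd.

Lemma ev_det X p v z : ev X p v z -> forall z', ev X p v z' -> z = z'.
Proof.
  revert p v z.
  apply (ev_nested_ind X (fun p v z => forall z', ev X p v z' -> z = z')
           (fun gs v ys => forall ys', evl X gs v ys' -> ys = ys')).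
  - intros v z' H; inversion H; auto.
  - intros v z' H; inversion H; auto.
  - intros i v z' H; inversion H; auto.
  - intros v Hx z' H; inversion H; subst; tauto.
  - intros v Hx z' H; inversion H; subst; tauto.
  - intros f gs v ys z _ IH1 _ IH2 z' H; inversion H; subst.
    apply IH2. erewrite IH1; eauto.
  - intros f g v z E _ IH z' H; inversion H; subst; [auto|congruence].
  - intros f g v n y z E _ IH1 _ IH2 z' H; inversion H; subst; [congruence|].
    assert (n = n0) by congruence; subst n0. apply IH2. erewrite IH1; eauto.
  - intros f v n _ IH Hlt z' H; inversion H as [| | | | | | | |? ? ? H0 Hl]; subst.
    destruct (lt_eq_lt_dec n z') as [[L|L]|L]; auto.
    + destruct (Hl n L) as [k Hk]. apply IH in Hk; discriminate.
    + destruct (Hlt z' L) as [k [_ Hk]]. apply Hk in H0; discriminate.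
  - intros v ys' H; inversion H; auto.
  - intros g gs v y ys _ IH1 _ IH2 ys' H; inversion H; subst. f_equal; auto.
Qed.

(** Functions are total on lists of every length, in keeping with the default value 0 of missing
    arguments, so compositions need no arities. *)
Definition compL (X : nat -> Prop) (f : list nat -> nat) : Prop :=
  exists p, forall v, ev X p v (f v).

Lemma compL_ext X f g : (forall v, f v = g v) -> compL X f -> compL X g.
Proof. intros E [p H]; exists p; intro v; rewrite <- E; apply H. Qed.

Lemma compL_nth X i : compL X (fun v => nth i v 0).
Proof. exists (PProj i); intro; constructor. Qed.

Lemma compL_zero X : compL X (fun _ => 0).
Proof. exists PZero; intro; constructor. Qed.

Lemma compL_comp X f gs : compL X f -> Forall (compL X) gs ->
  compL X (fun v => f (map (fun g => g v) gs)).
Proof.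
  intros [p Hp] Hg.
  assert (exists qs, forall v, evl X qs v (map (fun g => g v) gs)) as [qs Hq].
  { induction Hg as [|g gs [q Hq] _ [qs Hqs]].
    - exists []; intro; constructor.
    - exists (q :: qs); intro; constructor; auto. }
  exists (PComp p qs); intro v; econstructor; [apply Hq|apply Hp].
Qed.

Lemma compL_S X f : compL X f -> compL X (fun v => S (f v)).
Proof.
  intros Hf. apply (compL_comp X (fun w => S (hd 0 w)) [f]); [|auto].
  exists PSucc; intro; constructor.
Qed.

Lemma compL_2 X f g h : compL X f -> compL X g -> compL X h ->
  compL X (fun v => f [g v; h v]).
Proof. intros; apply (compL_comp X f [g; h]); auto. Qed.

Lemma compL_rec X f g : compL X f -> compL X g ->
  compL X (fun v => nat_rec (fun _ => nat) (f (tl v)) (fun n y => g (n :: y :: tl v)) (hd 0 v)).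
Proof.
  intros [p Hp] [q Hq]. exists (PPrec p q).
  assert (H : forall n v, hd 0 v = n -> ev X (PPrec p q) v
    (nat_rec (fun _ => nat) (f (tl v)) (fun n y => g (n :: y :: tl v)) n)).
  { induction n as [|n IH]; intros v E.
    - apply evPrec0; auto.
    - eapply evPrecS; [exact E| |cbn; apply Hq]. apply (IH (n :: tl v)); reflexivity. }
  intro v; apply H; reflexivity.
Qed.

Lemma compL_const X n : compL X (fun _ => n).
Proof. induction n; [apply compL_zero|apply (compL_S X (fun _ => n)); auto]. Qed.

Lemma compL_add X f g : compL X f -> compL X g -> compL X (fun v => f v + g v).
Proof.
  intros Hf Hg.
  apply (compL_2 X (fun w => nth 0 w 0 + nth 1 w 0)); auto.
  eapply compL_ext; [|apply (compL_rec X (fun v => nth 0 v 0) (fun v => S (nth 1 v 0)))].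
  - intros [|n v]; cbn; [reflexivity|]. induction n as [|n IHn]; cbn;
      [|rewrite IHn]; destruct v; cbn; lia.
  - apply compL_nth.
  - apply compL_S, compL_nth.
Qed.

Lemma compL_mul X f g : compL X f -> compL X g -> compL X (fun v => f v * g v).
Proof.
  intros Hf Hg.
  apply (compL_2 X (fun w => nth 0 w 0 * nth 1 w 0)); auto.
  eapply compL_ext; [|apply (compL_rec X (fun v => 0) (fun v => nth 1 v 0 + nth 2 v 0))].
  - intros [|n v]; cbn; [reflexivity|]. induction n as [|n IHn]; cbn;
      [|rewrite IHn]; destruct v; cbn; lia.
  - apply compL_zero.
  - apply compL_add; apply compL_nth.
Qed.

Lemma compL_pred X f : compL X f -> compL X (fun v => pred (f v)).
Proof.
  intros Hf.
  apply (compL_comp X (fun w => pred (nth 0 w 0)) [f]); [|auto].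
  eapply compL_ext; [|apply (compL_rec X (fun v => 0) (fun v => nth 0 v 0))].
  - intros [|[|n] v]; reflexivity.
  - apply compL_zero.
  - apply compL_nth.
Qed.

Lemma compL_sub X f g : compL X f -> compL X g -> compL X (fun v => f v - g v).
Proof.
  intros Hf Hg.
  apply (compL_2 X (fun w => nth 1 w 0 - nth 0 w 0)); auto.
  eapply compL_ext; [|apply (compL_rec X (fun v => nth 0 v 0) (fun v => pred (nth 1 v 0)))].
  - intros [|n v]; cbn; [reflexivity|]. induction n; cbn.
    + destruct v; cbn; lia.
    + rewrite IHn. destruct v; cbn; lia.
  - apply compL_nth.
  - apply compL_pred, compL_nth.
Qed.

(** * Cantor pairing *)

Definition pr (x y : nat) : nat := to_nat (x, y).
Definition p1 (c : nat) : nat := fst (of_nat c).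
Definition p2 (c : nat) : nat := snd (of_nat c).

Lemma p1_pr x y : p1 (pr x y) = x.
Proof. unfold p1, pr; rewrite cancel_of_to; reflexivity. Qed.
Lemma p2_pr x y : p2 (pr x y) = y.
Proof. unfold p2, pr; rewrite cancel_of_to; reflexivity. Qed.
Lemma pr_eta c : pr (p1 c) (p2 c) = c.
Proof. unfold p1, p2, pr; rewrite <- surjective_pairing; apply cancel_to_of. Qed.

(** Triangular numbers, by the same recursion as in [to_nat], so that [pr_tri] holds by
    computation. *)
Definition tri (n : nat) : nat := nat_rec (fun _ => nat) 0 (fun i m => S i + m) n.

Lemma tri_S n : tri (S n) = S n + tri n.
Proof. reflexivity. Qed.
Lemma pr_tri x y : pr x y = y + tri (y + x).
Proof. reflexivity. Qed.
Lemma tri_mono m n : m <= n -> tri m <= tri n.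
Proof. induction 1; auto. rewrite tri_S; lia. Qed.
Lemma tri_ge n : n <= tri n.
Proof. induction n; auto. rewrite tri_S; lia. Qed.

Lemma pr_mono x y x' y' : x <= x' -> y <= y' -> pr x y <= pr x' y'.
Proof. intros; rewrite !pr_tri. pose proof (tri_mono (y + x) (y' + x')); lia. Qed.
Lemma pr_ge1 x y : x <= pr x y.
Proof. rewrite pr_tri; pose proof (tri_ge (y + x)); lia. Qed.
Lemma pr_ge2 x y : y <= pr x y.
Proof. rewrite pr_tri; lia. Qed.
Lemma pr_gt2 x y : 0 < x -> y < pr x y.
Proof. rewrite pr_tri; pose proof (tri_ge (y + x)); lia. Qed.
Lemma p1_le c : p1 c <= c.
Proof. rewrite <- (pr_eta c) at 2; apply pr_ge1. Qed.
Lemma p2_le c : p2 c <= c.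
Proof. rewrite <- (pr_eta c) at 2; apply pr_ge2. Qed.

Lemma compL_tri X f : compL X f -> compL X (fun v => tri (f v)).
Proof.
  intros Hf. apply (compL_comp X (fun w => tri (nth 0 w 0)) [f]); [|auto].
  eapply compL_ext; [|apply (compL_rec X (fun v => 0) (fun v => S (nth 0 v 0) + nth 1 v 0))].
  - intros [|n v]; reflexivity.
  - apply compL_zero.
  - apply compL_add; [apply compL_S|]; apply compL_nth.
Qed.

Lemma compL_pr X f g : compL X f -> compL X g -> compL X (fun v => pr (f v) (g v)).
Proof.
  intros Hf Hg. apply (compL_add X g (fun v => tri (g v + f v))); auto.
  apply (compL_tri X (fun v => g v + f v)). apply compL_add; auto.
Qed.

(** The value chosen is the least zero, since [evMu] asks for positive values at all smaller
    arguments. *)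
Lemma compL_mu X f : compL X f -> (forall v, exists n, f (n :: v) = 0) ->
  exists g, compL X g /\ forall v, f (g v :: v) = 0.
Proof.
  intros [p Hp] Hex.
  assert (Hmin : forall v, exists n, f (n :: v) = 0 /\ forall m, m < n -> f (m :: v) <> 0).
  { intro v. destruct (Hex v) as [n Hn]. revert Hn.
    induction n as [n IH] using lt_wf_ind. intro Hn.
    destruct (classic (exists m, m < n /\ f (m :: v) = 0)) as [[m [Hm E]]|Hno].
    - apply (IH m); auto.
    - exists n; split; auto. intros m Hm E; apply Hno; eauto. }
  exists (fun v => proj1_sig (constructive_indefinite_description _ (Hmin v))).
  split.
  - exists (PMu p). intro v.
    destruct (constructive_indefinite_description _ (Hmin v)) as [n [E Hlt]]; cbn.
    apply evMu.
    + rewrite <- E; apply Hp.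
    + intros m Hm. exists (pred (f (m :: v))).
      replace (S (pred (f (m :: v)))) with (f (m :: v)); [apply Hp|].
      specialize (Hlt m Hm); lia.
  - intro v. destruct (constructive_indefinite_description _ (Hmin v)) as [n [E Hlt]]; auto.
Qed.

(* [p1 c + p2 c] is the largest [w] with [tri w <= c]. *)
Lemma compL_unpair X : compL X (fun v => p1 (nth 0 v 0) + p2 (nth 0 v 0)).
Proof.
  assert (E : forall c, c = p2 c + tri (p1 c + p2 c)).
  { intro c. rewrite <- (pr_eta c) at 1. rewrite pr_tri, (Nat.add_comm (p2 c) (p1 c)).
    reflexivity. }
  destruct (compL_mu X (fun v => (S (nth 1 v 0) - tri (S (nth 0 v 0))) +
     (tri (nth 0 v 0) - nth 1 v 0))) as [g [Hg Eg]].
  - apply compL_add; apply compL_sub; try apply compL_tri; repeat apply compL_S;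
      apply compL_nth.
  - intro v; cbn [nth]. set (c := nth 0 v 0).
    pose proof (E c). exists (p1 c + p2 c). rewrite tri_S.
    pose proof (tri_ge (p1 c + p2 c)). lia.
  - eapply compL_ext; [|exact Hg]. intro v. specialize (Eg v). cbn [nth] in Eg.
    set (c := nth 0 v 0) in *. specialize (E c).
    set (w := p1 c + p2 c) in *. set (g0 := g v) in *. rewrite tri_S in Eg.
    destruct (lt_eq_lt_dec g0 w) as [[H|H]|H]; auto.
    + pose proof (tri_mono (S g0) w H). rewrite tri_S in *. lia.
    + pose proof (tri_mono (S w) g0 H). rewrite tri_S in *. lia.
Qed.

(** * Computable functions, decidable and c.e. relations relative to an oracle *)

Definition comput (X : nat -> Prop) (f : nat -> nat) : Prop :=
  exists p, forall c, ev X p [c] (f c).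

Definition decid (X : nat -> Prop) (R : nat -> Prop) : Prop :=
  exists f, comput X f /\ forall c, R c <-> f c <> 0.

Definition sigma1 (X : nat -> Prop) (P : nat -> Prop) : Prop :=
  exists R, decid X R /\ forall c, P c <-> exists s, R (pr c s).

Lemma comput_ext X f g : (forall c, f c = g c) -> comput X f -> comput X g.
Proof. intros E [p H]; exists p; intro c; rewrite <- E; apply H. Qed.

Lemma comput_of_compL X f : compL X (fun v => f (nth 0 v 0)) -> comput X f.
Proof. intros [p H]; exists p; intro c; apply (H [c]). Qed.

Lemma comput_app X g f : comput X g -> comput X f -> comput X (fun c => g (f c)).
Proof.
  intros [p Hp] [q Hq]; exists (PComp p [q]); intro c.
  econstructor; [repeat constructor; apply Hq|apply Hp].
Qed.

Lemma comput_app2 X h f g : compL X (fun v => h (nth 0 v 0) (nth 1 v 0)) ->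
  comput X f -> comput X g -> comput X (fun c => h (f c) (g c)).
Proof.
  intros [p Hp] [q Hq] [r Hr]; exists (PComp p [q; r]); intro c.
  econstructor; [repeat constructor; [apply Hq|apply Hr]|apply (Hp [f c; g c])].
Qed.

Lemma comput_id X : comput X (fun c => c).
Proof. apply comput_of_compL, compL_nth. Qed.
Lemma comput_const X n : comput X (fun _ => n).
Proof. apply comput_of_compL, (compL_const X n). Qed.
Lemma comput_S X f : comput X f -> comput X (fun c => S (f c)).
Proof. apply comput_app, comput_of_compL, compL_S, compL_nth. Qed.
Lemma comput_pred X f : comput X f -> comput X (fun c => pred (f c)).
Proof. apply comput_app, comput_of_compL, compL_pred, compL_nth. Qed.
Lemma comput_add X f g : comput X f -> comput X g -> comput X (fun c => f c + g c).
Proof. apply comput_app2, compL_add; apply compL_nth. Qed.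
Lemma comput_mul X f g : comput X f -> comput X g -> comput X (fun c => f c * g c).
Proof. apply comput_app2, compL_mul; apply compL_nth. Qed.
Lemma comput_sub X f g : comput X f -> comput X g -> comput X (fun c => f c - g c).
Proof. apply comput_app2, compL_sub; apply compL_nth. Qed.
Lemma comput_pr X f g : comput X f -> comput X g -> comput X (fun c => pr (f c) (g c)).
Proof. apply comput_app2, compL_pr; apply compL_nth. Qed.

Lemma comput_p2 X f : comput X f -> comput X (fun c => p2 (f c)).
Proof.
  apply comput_app, comput_of_compL.
  apply (compL_ext X (fun v => nth 0 v 0 - tri (p1 (nth 0 v 0) + p2 (nth 0 v 0)))).
  - intro v. rewrite <- (pr_eta (nth 0 v 0)) at 1. rewrite pr_tri, Nat.add_comm.
    rewrite (Nat.add_comm (p2 _) (p1 _)). lia.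
  - apply compL_sub; [apply compL_nth|]. apply compL_tri, compL_unpair.
Qed.

Lemma comput_p1 X f : comput X f -> comput X (fun c => p1 (f c)).
Proof.
  intro Hf.
  apply (comput_app X (fun c => (p1 c + p2 c) - p2 c)) in Hf.
  - eapply comput_ext; [|exact Hf]. intro; cbn; lia.
  - apply comput_sub; [apply comput_of_compL, compL_unpair|apply comput_p2, comput_id].
Qed.

Lemma comput_rec X g h k : comput X g ->
  comput X (fun w => h (p1 (p1 w)) (p2 (p1 w)) (p2 w)) -> comput X k ->
  comput X (fun c => nat_rec (fun _ => nat) (g c) (fun n y => h c n y) (k c)).
Proof.
  intros [p Hp] [q Hq] Hk.
  assert (Hpr : exists r, forall x y, ev X r [x; y] (pr x y)).
  { destruct (compL_pr X (fun v => nth 0 v 0) (fun v => nth 1 v 0)) as [r Hr];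
      try apply compL_nth. exists r. intros x y; apply (Hr [x; y]). }
  destruct Hpr as [r Hr]. destruct Hk as [s Hs].
  (* [PPrec] passes the counter, the previous value and the parameter in this order; the inner
     compositions repack them as [pr (pr c n) y], the form of argument that [q] expects. *)
  exists (PComp (PPrec p (PComp q [PComp r [PComp r [PProj 2; PProj 0]; PProj 1]]))
            [s; PProj 0]).
  intro c. econstructor; [repeat constructor; apply Hs|].
  cbn [nth]. induction (k c) as [|n IH].
  - apply evPrec0; [reflexivity|apply Hp].
  - eapply evPrecS; [reflexivity|exact IH|]. cbn [tl].
    set (y := nat_rec _ _ _ n).
    assert (E : h c n y = h (p1 (p1 (pr (pr c n) y))) (p2 (p1 (pr (pr c n) y)))
                            (p2 (pr (pr c n) y))) by (rewrite !p1_pr, !p2_pr; reflexivity).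
    cbn [nat_rec nat_rect]. fold y.
    change (ev X (PComp q [PComp r [PComp r [PProj 2; PProj 0]; PProj 1]]) [n; y; c] (h c n y)).
    rewrite E. econstructor; [|apply Hq].
    repeat econstructor; apply Hr.
Qed.

Lemma decid_ext X P Q : (forall c, P c <-> Q c) -> decid X P -> decid X Q.
Proof. intros E [f [H1 H2]]; exists f; split; auto. intro; rewrite <- E; auto. Qed.

Lemma decid_app X R f : decid X R -> comput X f -> decid X (fun c => R (f c)).
Proof.
  intros [g [Hg E]] Hf. exists (fun c => g (f c)); split; auto. apply comput_app; auto.
Qed.

Lemma decid_app2 X R f g : decid X (fun w => R (p1 w) (p2 w)) -> comput X f -> comput X g ->
  decid X (fun c => R (f c) (g c)).
Proof.
  intros H Hf Hg. apply (decid_ext X (fun c => R (p1 (pr (f c) (g c))) (p2 (pr (f c) (g c))))).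
  - intro; rewrite p1_pr, p2_pr; tauto.
  - apply (decid_app X (fun w => R (p1 w) (p2 w))); auto. apply comput_pr; auto.
Qed.

(** Non-uniform: excluded middle selects one of two constant programs. *)
Lemma decid_const X (P : Prop) : decid X (fun _ => P).
Proof.
  destruct (classic P); [exists (fun _ => 1)|exists (fun _ => 0)];
    (split; [apply comput_const|intro; split; auto; tauto]).
Qed.

Lemma decid_not X R : decid X R -> decid X (fun c => ~ R c).
Proof.
  intros [f [Hf E]]; exists (fun c => 1 - f c); split.
  - apply comput_sub; auto; apply comput_const.
  - intro c; rewrite E; lia.
Qed.

Lemma decid_and X P Q : decid X P -> decid X Q -> decid X (fun c => P c /\ Q c).
Proof.
  intros [f [Hf E]] [g [Hg E']]; exists (fun c => f c * g c); split.
  - apply comput_mul; auto.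
  - intro c; rewrite E, E'; nia.
Qed.

Lemma decid_imp X P Q : decid X P -> decid X Q -> decid X (fun c => P c -> Q c).
Proof.
  intros HP HQ. apply (decid_ext X (fun c => ~ (P c /\ ~ Q c))).
  - intro; tauto.
  - apply decid_not, decid_and; auto. apply decid_not; auto.
Qed.

Lemma decid_or X P Q : decid X P -> decid X Q -> decid X (fun c => P c \/ Q c).
Proof.
  intros HP HQ. apply (decid_ext X (fun c => ~ P c -> Q c)).
  - intro; tauto.
  - apply decid_imp; auto. apply decid_not; auto.
Qed.

Lemma decid_iff X P Q : decid X P -> decid X Q -> decid X (fun c => P c <-> Q c).
Proof. intros; apply decid_and; apply decid_imp; auto. Qed.

Lemma decid_le X f g : comput X f -> comput X g -> decid X (fun c => f c <= g c).
Proof.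
  intros; exists (fun c => S (g c) - f c); split; [|intro; lia].
  apply comput_sub; auto; apply comput_S; auto.
Qed.

Lemma decid_lt X f g : comput X f -> comput X g -> decid X (fun c => f c < g c).
Proof. intros; apply (decid_le X (fun c => S (f c))); auto; apply comput_S; auto. Qed.

Lemma decid_eq X f g : comput X f -> comput X g -> decid X (fun c => f c = g c).
Proof.
  intros. apply (decid_ext X (fun c => f c <= g c /\ g c <= f c)); [intro; lia|].
  apply decid_and; apply decid_le; auto.
Qed.

Lemma decid_ball X b R : comput X b -> decid X (fun w => R (p1 w) (p2 w)) ->
  decid X (fun c => forall y, y < b c -> R c y).
Proof.
  intros Hb [f [Hf E]].
  exists (fun c => nat_rec (fun _ => nat) 1 (fun n y => y * f (pr c n)) (b c)). split.
  - apply (comput_rec X (fun _ => 1) (fun c n y => y * f (pr c n))); auto;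
      [apply comput_const|].
    apply (comput_mul X (fun w => p2 w)); [apply comput_p2, comput_id|].
    apply comput_app; auto. apply comput_pr; [apply comput_p1|apply comput_p2]; apply comput_p1, comput_id.
  - intro c. assert (E' : forall n, R c n <-> f (pr c n) <> 0).
    { intro n; rewrite <- E, p1_pr, p2_pr; tauto. }
    clear E Hb. induction (b c) as [|n IH]; cbn [nat_rec nat_rect].
    + split; [lia|intros _ y Hy; lia].
    + rewrite <- Nat.neq_mul_0, <- E'. unfold nat_rec in IH. rewrite <- IH. split.
      * intro H; split; [intros y Hy; apply H; lia|apply H; lia].
      * intros [H1 H2] y Hy. destruct (Nat.eq_dec y n); [subst; auto|apply H1; lia].
Qed.

Lemma decid_bex X b R : comput X b -> decid X (fun w => R (p1 w) (p2 w)) ->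
  decid X (fun c => exists y, y < b c /\ R c y).
Proof.
  intros Hb HR. apply (decid_ext X (fun c => ~ forall y, y < b c -> ~ R c y)).
  - intro c; split.
    + intro H. apply NNPP; intro H'. apply H; intros y Hy Hr; apply H'; eauto.
    + intros [y [Hy Hr]] H; apply (H y); auto.
  - apply decid_not, (decid_ball X b (fun c y => ~ R c y)); auto.
    apply (decid_not X (fun w => R (p1 w) (p2 w))); auto.
Qed.

Lemma decid_oracle X f : comput X f -> decid X (fun c => X (f c)).
Proof.
  intros [p Hp].
  exists (fun c => if excluded_middle_informative (X (f c)) then 1 else 0). split.
  - exists (PComp POracle [p]); intro c. econstructor; [repeat constructor; apply Hp|].
    destruct (excluded_middle_informative _); constructor; auto.
  - intro c. destruct (excluded_middle_informative _); split; auto; lia.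
Qed.

Lemma comput_mu X R : decid X (fun w => R (p1 w) (p2 w)) -> (forall c, exists s, R c s) ->
  exists g, comput X g /\ forall c, R c (g c).
Proof.
  intros [f [Hf E]] Hex.
  assert (Hf' : compL X (fun v => 1 - f (pr (nth 1 v 0) (nth 0 v 0)))).
  { apply compL_sub; [apply compL_const|]. destruct Hf as [p Hp].
    destruct (compL_pr X (fun v => nth 1 v 0) (fun v => nth 0 v 0)) as [q Hq];
      try apply compL_nth.
    exists (PComp p [q]); intro v. econstructor; [repeat constructor; apply Hq|apply Hp]. }
  assert (E' : forall c s, R c s <-> f (pr c s) <> 0).
  { intros c s; rewrite <- E, p1_pr, p2_pr; tauto. }
  destruct (compL_mu X _ Hf') as [g [Hg Eg]].
  - intro v; cbn [nth]. destruct (Hex (nth 0 v 0)) as [s Hs]. exists s.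
    apply E' in Hs. lia.
  - exists (fun c => g [c]); split.
    + destruct Hg as [p Hp]; exists p; intro c; apply Hp.
    + intro c. apply E'. specialize (Eg [c]); cbn [nth] in Eg. lia.
Qed.

Lemma comput_graph X f R : decid X (fun w => R (p1 w) (p2 w)) -> (forall c, R c (f c)) ->
  (forall c y, R c y -> y = f c) -> comput X f.
Proof.
  intros HR H1 H2. destruct (comput_mu X R HR) as [g [Hg Eg]]; [eauto|].
  eapply comput_ext; [|exact Hg]. intro; apply H2; auto.
Qed.

Lemma sigma1_ext X P Q : (forall c, P c <-> Q c) -> sigma1 X P -> sigma1 X Q.
Proof. intros E [f [H1 H2]]; exists f; split; auto. intro; rewrite <- E; auto. Qed.

Lemma sigma1_intro X P R : decid X (fun w => R (p1 w) (p2 w)) ->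
  (forall c, P c <-> exists s, R c s) -> sigma1 X P.
Proof.
  intros H E; exists (fun w => R (p1 w) (p2 w)); split; auto.
  intro c; rewrite E. split; intros [s Hs]; exists s; revert Hs; rewrite p1_pr, p2_pr; auto.
Qed.

Lemma sigma1_elim X P : sigma1 X P -> exists R, decid X (fun w => R (p1 w) (p2 w)) /\
  forall c, P c <-> exists s, R c s.
Proof.
  intros [R [H E]]; exists (fun c s => R (pr c s)); split; auto.
  eapply decid_ext; [|exact H]. intro w; cbv beta; rewrite pr_eta; tauto.
Qed.

Lemma sigma1_dec X R : decid X R -> sigma1 X R.
Proof.
  intro H; apply (sigma1_intro X R (fun c _ => R c)).
  - apply decid_app; auto; apply comput_p1, comput_id.
  - intro c; split; [intro; exists 0; auto|intros [_ h]; auto].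
Qed.

Lemma sigma1_app X P f : sigma1 X P -> comput X f -> sigma1 X (fun c => P (f c)).
Proof.
  intros [R [H E]]%sigma1_elim Hf. apply (sigma1_intro X _ (fun c s => R (f c) s)).
  - apply (decid_app2 X R (fun w => f (p1 w)) p2); auto.
    + apply comput_app; auto; apply comput_p1, comput_id.
    + apply comput_p2, comput_id.
  - intro; apply E.
Qed.

Lemma sigma1_app2 X R f g : sigma1 X (fun w => R (p1 w) (p2 w)) -> comput X f -> comput X g ->
  sigma1 X (fun c => R (f c) (g c)).
Proof.
  intros H Hf Hg. apply (sigma1_ext X (fun c => R (p1 (pr (f c) (g c))) (p2 (pr (f c) (g c))))).
  - intro; rewrite p1_pr, p2_pr; tauto.
  - apply (sigma1_app X (fun w => R (p1 w) (p2 w))); auto. apply comput_pr; auto.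
Qed.

Lemma sigma1_and X P Q : sigma1 X P -> sigma1 X Q -> sigma1 X (fun c => P c /\ Q c).
Proof.
  intros [R [H E]]%sigma1_elim [R' [H' E']]%sigma1_elim.
  apply (sigma1_intro X _ (fun c s => R c (p1 s) /\ R' c (p2 s))).
  - apply decid_and; (apply decid_app2; auto; [apply comput_p1, comput_id|]);
      [apply comput_p1|apply comput_p2]; apply comput_p2, comput_id.
  - intro c; rewrite E, E'; split.
    + intros [[s Hs] [t Ht]]; exists (pr s t); rewrite p1_pr, p2_pr; auto.
    + intros [s [Hs Ht]]; eauto.
Qed.

Lemma sigma1_or X P Q : sigma1 X P -> sigma1 X Q -> sigma1 X (fun c => P c \/ Q c).
Proof.
  intros [R [H E]]%sigma1_elim [R' [H' E']]%sigma1_elim.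
  apply (sigma1_intro X _ (fun c s => R c s \/ R' c s)).
  - apply decid_or; auto.
  - intro c; rewrite E, E'; split.
    + intros [[s Hs]|[s Hs]]; eauto.
    + intros [s [Hs|Hs]]; eauto.
Qed.

Lemma sigma1_imp X P Q : decid X P -> sigma1 X Q -> sigma1 X (fun c => P c -> Q c).
Proof.
  intros HP HQ. apply (sigma1_ext X (fun c => ~ P c \/ Q c)); [intro; tauto|].
  apply sigma1_or; auto. apply sigma1_dec, decid_not; auto.
Qed.

Lemma sigma1_ex X P : sigma1 X (fun w => P (p1 w) (p2 w)) -> sigma1 X (fun c => exists y, P c y).
Proof.
  intros [R [H E]]%sigma1_elim.
  apply (sigma1_intro X _ (fun c s => R (pr c (p1 s)) (p2 s))).
  - apply (decid_app2 X R (fun w => pr (p1 w) (p1 (p2 w))) (fun w => p2 (p2 w))); auto.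
    + apply comput_pr; [apply comput_p1, comput_id|apply comput_p1, comput_p2, comput_id].
    + apply comput_p2, comput_p2, comput_id.
  - intro c. assert (E' : forall y, P c y <-> exists s, R (pr c y) s).
    { intro y; rewrite <- E, p1_pr, p2_pr; tauto. }
    split.
    + intros [y [s Hs]%E']; exists (pr y s); rewrite p1_pr, p2_pr; auto.
    + intros [s Hs]; exists (p1 s); apply E'; eauto.
Qed.

(** Lets a bounded universal quantifier move inside an unbounded existential one. *)
Lemma collection (n : nat) (P : nat -> nat -> Prop) :
  (forall y, y < n -> exists s, P y s) ->
  exists b, forall y, y < n -> exists s, s < b /\ P y s.
Proof.
  induction n as [|n IH]; intro H.
  - exists 0; intros; lia.
  - destruct IH as [b Hb]; [intros; apply H; lia|].
    destruct (H n) as [s Hs]; [lia|]. exists (S (b + s)). intros y Hy.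
    destruct (Nat.eq_dec y n) as [->|Hn].
    + exists s; split; auto; lia.
    + destruct (Hb y) as [t [Ht Hp]]; [lia|]. exists t; split; auto; lia.
Qed.

Lemma sigma1_ball X b P : comput X b -> sigma1 X (fun w => P (p1 w) (p2 w)) ->
  sigma1 X (fun c => forall y, y < b c -> P c y).
Proof.
  intros Hb [R [H E]]%sigma1_elim.
  assert (E' : forall c y, P c y <-> exists s, R (pr c y) s).
  { intros c y; rewrite <- E, p1_pr, p2_pr; tauto. }
  apply (sigma1_intro X _ (fun c t => forall y, y < b c -> exists s, s < t /\ R (pr c y) s)).
  - apply (decid_ball X (fun w => b (p1 w))
      (fun w y => exists s, s < p2 w /\ R (pr (p1 w) y) s)).
    + apply comput_app; auto; apply comput_p1, comput_id.
    + apply (decid_bex X (fun w => p2 (p1 w)) (fun w s => R (pr (p1 (p1 w)) (p2 w)) s)).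
      * apply comput_p2, comput_p1, comput_id.
      * apply (decid_app2 X R (fun w => pr (p1 (p1 (p1 w))) (p2 (p1 w))) p2); auto.
        -- apply comput_pr; [apply comput_p1, comput_p1, comput_p1, comput_id|].
           apply comput_p2, comput_p1, comput_id.
        -- apply comput_p2, comput_id.
  - intro c; split.
    + intro Hc. apply (collection (b c) (fun y s => R (pr c y) s)).
      intros y Hy; apply E'; auto.
    + intros [t Ht] y Hy. destruct (Ht y Hy) as [s [_ Hs]]. apply E'; eauto.
Qed.

Lemma comput_pow2 X f : comput X f -> comput X (fun c => 2 ^ f c).
Proof.
  intro Hf. apply (comput_ext X (fun c => nat_rec (fun _ => nat) 1 (fun _ y => y + y) (f c))).
  - intro c; induction (f c) as [|n IH]; auto. cbn in *. rewrite IH. lia.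
  - apply (comput_rec X (fun _ => 1) (fun _ _ y => y + y)); auto; [apply comput_const|].
    apply comput_add; apply comput_p2, comput_id.
Qed.

(** * Finite sets as binary masks *)

Definition bit (d x : nat) : Prop := Nat.testbit d x = true.

(** Division by [2 ^ x] turns the bit into a formula with bounded quantifiers, from which
    [decid_bit] follows. *)
Lemma bit_spec d x : bit d x <->
  exists q, q < S d /\ exists r, r < 2 ^ x /\ d = (2 * q + 1) * 2 ^ x + r.
Proof.
  unfold bit. rewrite Nat.testbit_true. assert (Hp : 2 ^ x <> 0) by (apply Nat.pow_nonzero; lia).
  pose proof (Nat.div_mod_eq d (2 ^ x)) as E1.
  pose proof (Nat.div_mod_eq (d / 2 ^ x) 2) as E2.
  pose proof (Nat.mod_upper_bound d (2 ^ x) Hp) as L1.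
  split.
  - intro H. exists ((d / 2 ^ x) / 2). split; [nia|].
    exists (d mod 2 ^ x). split; [lia|]. nia.
  - intros [q [_ [r [Hr E]]]].
    assert (d / 2 ^ x = 2 * q + 1) as ->.
    { symmetry. apply (Nat.div_unique d (2 ^ x) (2 * q + 1) r); auto. lia. }
    rewrite Nat.add_comm, Nat.mul_comm, Nat.Div0.mod_add. reflexivity.
Qed.

Lemma bit_lt d x : bit d x -> x < d.
Proof.
  intros [q [_ [r [Hr E]]]]%bit_spec. pose proof (Nat.pow_gt_lin_r 2 x). nia.
Qed.

Lemma bit_ext d d' : (forall x, bit d x <-> bit d' x) -> d = d'.
Proof.
  intro H. apply Nat.bits_inj. intro x. specialize (H x). unfold bit in H.
  destruct (Nat.testbit d x), (Nat.testbit d' x); intuition congruence.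
Qed.

(** The mask of the part of [X] below [l]: the finite information that a computation can use about
    its oracle. *)
Fixpoint res (X : nat -> Prop) (l : nat) : nat :=
  match l with
  | 0 => 0
  | S l' => 2 * res (fun x => X (S x)) l' +
            Nat.b2n (if excluded_middle_informative (X 0) then true else false)
  end.

Lemma res_spec X l x : bit (res X l) x <-> x < l /\ X x.
Proof.
  unfold bit. revert X x; induction l as [|l IH]; intros X x; cbn [res].
  - rewrite Nat.bits_0. split; [discriminate|lia].
  - destruct x as [|x].
    + rewrite Nat.testbit_0_r. destruct (excluded_middle_informative _); intuition lia.
    + rewrite Nat.testbit_succ_r, IH. intuition lia.
Qed.

Lemma res_lt X l : res X l < 2 ^ l.
Proof.
  revert X; induction l as [|l IH]; intro X; cbn [res]; [cbn; lia|].
  specialize (IH (fun x => X (S x))). rewrite Nat.pow_succ_r'.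
  destruct (excluded_middle_informative _); cbn [Nat.b2n]; lia.
Qed.

Lemma res_bit X l x : x < l -> bit (res X l) x <-> X x.
Proof. intro; rewrite res_spec; tauto. Qed.

Lemma res_ext X Y l : (forall x, x < l -> (X x <-> Y x)) -> res X l = res Y l.
Proof. intro H; apply bit_ext; intro x; rewrite !res_spec. split; intros [? ?]; split; auto; apply H; auto. Qed.

Lemma res_res X l L : l <= L -> res (bit (res X L)) l = res X l.
Proof. intro H; apply res_ext; intros x Hx; apply res_bit; lia. Qed.

Lemma bit_bound d l x : d < 2 ^ l -> bit d x -> x < l.
Proof.
  intros H [q [_ [r [Hr E]]]]%bit_spec.
  destruct (le_lt_dec l x) as [Hl|]; auto.
  pose proof (Nat.pow_le_mono_r 2 l x). nia.
Qed.

Lemma res_of_bit d l : d < 2 ^ l -> res (bit d) l = d.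
Proof.
  intro H; apply bit_ext; intro x; rewrite res_spec. split; [tauto|].
  intro Hb; split; auto. eapply bit_bound; eauto.
Qed.

Lemma decid_bit X f g : comput X f -> comput X g -> decid X (fun c => bit (f c) (g c)).
Proof.
  intros Hf Hg.
  apply (decid_app2 X bit f g); auto.
  eapply decid_ext; [intro c; symmetry; apply bit_spec|].
  apply (decid_bex X (fun w => S (p1 w)) (fun w q => exists r, r < 2 ^ p2 w /\
     p1 w = (2 * q + 1) * 2 ^ p2 w + r)).
  { apply comput_S, comput_p1, comput_id. }
  apply (decid_bex X (fun w => 2 ^ p2 (p1 w)) (fun w r =>
     p1 (p1 w) = (2 * p2 w + 1) * 2 ^ p2 (p1 w) + r)).
  { apply comput_pow2, comput_p2, comput_p1, comput_id. }
  apply decid_eq.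
  { apply comput_p1, comput_p1, comput_p1, comput_id. }
  apply comput_add; [|apply comput_p2, comput_id].
  apply comput_mul; [|apply comput_pow2, comput_p2, comput_p1, comput_p1, comput_id].
  apply comput_add; [|apply comput_const].
  apply comput_mul; [apply comput_const|apply comput_p2, comput_p1, comput_id].
Qed.

(** * Automatic closure properties of computable functions and relations *)

Ltac cs_more := fail.
(** Directed by the syntax of the function or relation; [cs_more] is a hook, redefined below as
    further operations are shown computable. *)
Ltac cs_step :=
  cbv beta;
  match goal with
  | |- _ => cs_more
  | H : comput ?X ?f |- comput ?X ?f => exact H
  | |- comput _ (fun _ => ?n) => apply comput_const
  | |- comput _ (fun c => c) => apply comput_id
  | |- comput _ (fun c => S _) => apply comput_S
  | |- comput _ (fun c => pred _) => apply comput_pred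
  | |- comput _ (fun c => p1 _) => apply comput_p1
  | |- comput _ (fun c => p2 _) => apply comput_p2
  | |- comput _ (fun c => pr _ _) => apply comput_pr
  | |- comput _ (fun c => _ + _) => apply comput_add
  | |- comput _ (fun c => _ * _) => apply comput_mul
  | |- comput _ (fun c => _ - _) => apply comput_sub
  | |- comput _ (fun c => 2 ^ _) => apply comput_pow2
  | H : comput ?X ?f |- comput ?X (fun c => ?f (@?g c)) => apply (comput_app X f g H)
  | H : decid ?X ?R |- decid ?X ?R => exact H
  | |- decid _ (fun _ => ?P) => apply decid_const
  | |- decid _ (fun c => bit _ _) => apply decid_bit
  | |- decid _ (fun c => _ < _) => apply decid_lt
  | |- decid _ (fun c => _ <= _) => apply decid_le
  | |- decid _ (fun c => _ = _) => apply decid_eq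
  | |- decid _ (fun c => _ <-> _) => apply decid_iff
  | |- decid _ (fun c => _ /\ _) => apply decid_and
  | |- decid _ (fun c => _ \/ _) => apply decid_or
  | |- decid _ (fun c => ~ _) => apply decid_not
  | |- decid _ (fun c => forall y, y < _ -> _) => apply decid_ball
  | |- decid _ (fun c => exists y, y < _ /\ _) => apply decid_bex
  | H : decid ?X ?R |- decid ?X (fun c => ?R (@?f c)) => apply (decid_app X R f H)
  | H : decid ?X (fun w => ?R (p1 w) (p2 w)) |- decid ?X (fun c => ?R (@?f c) (@?g c)) =>
      apply (decid_app2 X R f g H)
  | |- decid ?X (fun c => ?X _) => apply decid_oracle
  | |- decid _ (fun c => _ -> _) => apply decid_imp
  | H : sigma1 ?X ?R |- sigma1 ?X ?R => exact H
  | |- sigma1 _ (fun _ => ?P) => apply sigma1_dec, decid_const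
  | |- sigma1 _ (fun c => _ /\ _) => apply sigma1_and
  | |- sigma1 _ (fun c => _ \/ _) => apply sigma1_or
  | |- sigma1 _ (fun c => forall y, y < _ -> _) => apply sigma1_ball
  | |- sigma1 _ (fun c => exists y, _) => apply sigma1_ex
  | H : sigma1 ?X ?R |- sigma1 ?X (fun c => ?R (@?f c)) => apply (sigma1_app X R f H)
  | H : sigma1 ?X (fun w => ?R (p1 w) (p2 w)) |- sigma1 ?X (fun c => ?R (@?f c) (@?g c)) =>
      apply (sigma1_app2 X R f g H)
  | |- sigma1 _ (fun c => ~ _) => apply sigma1_dec
  | |- sigma1 _ (fun c => _ -> _) => apply sigma1_imp
  | |- comput ?X ?f => lazymatch f with (fun _ => _) => fail | _ => change (comput X (fun c => f c)) end
  | |- decid ?X ?f => lazymatch f with (fun _ => _) => fail | _ => change (decid X (fun c => f c)) end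
  | |- sigma1 _ _ => apply sigma1_dec
  end.
Ltac cs := repeat cs_step.

Lemma comput_res X R g : decid X (fun w => R (p1 w) (p2 w)) -> comput X g ->
  comput X (fun c => res (R c) (g c)).
Proof.
  intros HR Hg.
  apply (comput_graph X _ (fun c d => d < 2 ^ g c /\ forall x, x < g c -> (bit d x <-> R c x))).
  - cs.
  - intro c; split; [apply res_lt|]. intros; apply res_bit; auto.
  - intros c y [Hy H]. rewrite <- (res_of_bit y (g c) Hy). apply res_ext; auto.
Qed.

Lemma comput_iter X h f k : comput X h -> comput X f -> comput X k ->
  comput X (fun c => Nat.iter (k c) h (f c)).
Proof.
  intros Hh Hf Hk.
  apply (comput_ext X (fun c => nat_rec (fun _ => nat) (f c) (fun _ y => h y) (k c))).
  - reflexivity.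
  - apply (comput_rec X f (fun _ _ y => h y)); cs.
Qed.

Ltac cs_more ::= apply comput_res.

(** * Arithmetization of the evaluation relation *)

Definition decodel (b : nat) : list prog := decl (S b) b.

(** Codes in recursive calls are strictly smaller, so fuel above the code does not affect the
    result; this gives the fuel-free equations [decode_eq] and [decodel_S]. *)
Lemma dec_fuel n : forall e k k', e <= n -> e < k -> e < k' ->
  dec k e = dec k' e /\ decl k e = decl k' e.
Proof.
  induction n as [n IH] using lt_wf_ind. intros e k k' He Hk Hk'.
  destruct k as [|k], k' as [|k']; try lia. cbn [dec decl]. split.
  - pose proof (surjective_pairing (of_nat e)) as E. fold (p1 e) (p2 e) in E. rewrite E.
    destruct (Nat.eq_dec (p1 e) 0) as [->|Hz]; auto.
    (* A nonzero tag is what makes the second component strictly smaller than the code. *)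
    assert (Hr : p2 e < e).
    { rewrite <- (pr_eta e) at 2. apply pr_gt2; lia. }
    pose proof (surjective_pairing (of_nat (p2 e))) as E2.
    fold (p1 (p2 e)) (p2 (p2 e)) in E2.
    pose proof (p1_le (p2 e)). pose proof (p2_le (p2 e)).
    destruct (p1 e) as [|[|[|[|[|[|[|t]]]]]]]; auto; rewrite ?E2.
    + f_equal; apply (IH (n - 1)); lia.
    + f_equal; apply (IH (n - 1)); lia.
    + f_equal; apply (IH (n - 1)); lia.
  - destruct e as [|m]; auto.
    pose proof (surjective_pairing (of_nat m)) as E2.
    fold (p1 m) (p2 m) in E2. rewrite E2.
    pose proof (p1_le m). pose proof (p2_le m).
    f_equal; apply (IH (n - 1)); lia.
Qed.

Lemma dec_decode k e : e < k -> dec k e = decode e.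
Proof. intro; apply (dec_fuel e); lia. Qed.

Lemma decl_decodel k e : e < k -> decl k e = decodel e.
Proof. intro; apply (dec_fuel e); lia. Qed.

Lemma decode_eq e : decode e =
  match p1 e with
  | 0 => PZero | 1 => PSucc | 2 => PProj (p2 e) | 3 => POracle
  | 4 => PComp (decode (p1 (p2 e))) (decodel (p2 (p2 e)))
  | 5 => PPrec (decode (p1 (p2 e))) (decode (p2 (p2 e)))
  | 6 => PMu (decode (p2 e))
  | _ => PZero
  end.
Proof.
  unfold decode at 1; cbn [dec].
  pose proof (surjective_pairing (of_nat e)) as E. fold (p1 e) (p2 e) in E. rewrite E.
  destruct (Nat.eq_dec (p1 e) 0) as [->|Hz]; auto.
  assert (Hr : p2 e < e).
  { rewrite <- (pr_eta e) at 2. apply pr_gt2; lia. }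
  pose proof (surjective_pairing (of_nat (p2 e))) as E2.
  fold (p1 (p2 e)) (p2 (p2 e)) in E2.
  pose proof (p1_le (p2 e)). pose proof (p2_le (p2 e)).
  destruct (p1 e) as [|[|[|[|[|[|[|t]]]]]]]; auto; rewrite ?E2.
  - rewrite dec_decode, decl_decodel by lia; auto.
  - rewrite !dec_decode by lia; auto.
  - rewrite dec_decode by lia; auto.
Qed.

Lemma decodel_S m : decodel (S m) = decode (p1 m) :: decodel (p2 m).
Proof.
  change (decodel (S m)) with (let (c, d) := of_nat m in dec (S m) c :: decl (S m) d).
  pose proof (surjective_pairing (of_nat m)) as E2. fold (p1 m) (p2 m) in E2. rewrite E2.
  pose proof (p1_le m). pose proof (p2_le m).
  rewrite dec_decode, decl_decodel by lia; auto.
Qed.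

Fixpoint code (p : prog) : nat :=
  match p with
  | PZero => pr 0 0
  | PSucc => pr 1 0
  | PProj i => pr 2 i
  | POracle => pr 3 0
  | PComp f gs => pr 4 (pr (code f) (fold_right (fun g c => S (pr (code g) c)) 0 gs))
  | PPrec f g => pr 5 (pr (code f) (code g))
  | PMu f => pr 6 (code f)
  end.

Lemma decode_code : forall p, decode (code p) = p.
Proof.
  fix IH 1. intros [| |i| |f gs|f g|f]; rewrite decode_eq; cbn [code];
    repeat rewrite ?p1_pr, ?p2_pr; auto.
  - f_equal; [apply IH|]. induction gs as [|g gs IHg]; cbn [fold_right]; auto.
    rewrite decodel_S, p1_pr, p2_pr. f_equal; [apply IH|apply IHg].
  - f_equal; apply IH.
  - f_equal; apply IH.
Qed.

(* Coded lists: [hdc 0 = 0] and [tlc 0 = 0], in agreement with [hd 0 []] and [tl []]. *)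
Definition hdc (v : nat) : nat := p1 (pred v).
Definition tlc (v : nat) : nat := p2 (pred v).
Definition consc (a v : nat) : nat := S (pr a v).

Fixpoint lld (k v : nat) : list nat :=
  match k with
  | 0 => []
  | S k => match v with 0 => [] | S m => p1 m :: lld k (p2 m) end
  end.
Definition ll (v : nat) : list nat := lld v v.

Lemma lld_fuel n : forall v k k', v <= n -> v <= k -> v <= k' -> lld k v = lld k' v.
Proof.
  induction n as [n IH] using lt_wf_ind. intros v k k' Hv Hk Hk'.
  destruct v as [|m]; [destruct k, k'; auto|].
  destruct k as [|k], k' as [|k']; try lia. cbn. pose proof (p2_le m).
  f_equal. apply (IH (n - 1)); lia.
Qed.

Lemma ll_S m : ll (S m) = p1 m :: ll (p2 m).
Proof.
  unfold ll at 1; cbn. f_equal. pose proof (p2_le m). apply (lld_fuel m); auto.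
Qed.
Lemma ll_cons a v : ll (consc a v) = a :: ll v.
Proof. unfold consc; rewrite ll_S, p1_pr, p2_pr; auto. Qed.
Lemma ll_hd v : hd 0 (ll v) = hdc v.
Proof. destruct v; [reflexivity|rewrite ll_S; reflexivity]. Qed.
Lemma ll_tl v : tl (ll v) = ll (tlc v).
Proof. destruct v; [reflexivity|rewrite ll_S; reflexivity]. Qed.
Lemma ll_nth i : forall v, nth i (ll v) 0 = hdc (Nat.iter i tlc v).
Proof.
  induction i as [|i IH]; intro v.
  - change (Nat.iter 0 tlc v) with v. rewrite <- ll_hd. destruct (ll v); reflexivity.
  - rewrite Nat.iter_succ_r, <- IH, <- ll_tl. destruct (ll v); destruct i; reflexivity.
Qed.
Lemma ll_surj l : exists v, ll v = l.
Proof.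
  induction l as [|a l [v IH]]; [exists 0; auto|].
  exists (consc a v); rewrite ll_cons; congruence.
Qed.

(* [fact r k a v z]: with derivation rank [r], the program coded by [a] maps the
   coded arguments [v] to [z] ([k = 0]), resp. the coded list of programs [a] maps
   [v] to the coded list [z] ([k = 1]). *)
Definition fact (r k a v z : nat) : nat := pr r (pr k (pr a (pr v z))).

(** * Finite derivations as sets of coded facts *)

Lemma pr_inj x y x' y' : pr x y = pr x' y' -> x = x' /\ y = y'.
Proof.
  intro H. split; [rewrite <- (p1_pr x y), H; apply p1_pr|rewrite <- (p2_pr x y), H; apply p2_pr].
Qed.

Lemma fact_inj r k a v z r' k' a' v' z' : fact r k a v z = fact r' k' a' v' z' ->
  r = r' /\ k = k' /\ a = a' /\ v = v' /\ z = z'.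
Proof.
  unfold fact. intro H. apply pr_inj in H as [-> H]. apply pr_inj in H as [-> H].
  apply pr_inj in H as [-> H]. apply pr_inj in H as [-> H]. auto.
Qed.

(** Premises must have smaller rank; this rules out circular justifications and provides the
    induction in [valid_sound]. *)
Definition mem (S : nat -> Prop) (r k a v z : nat) : Prop :=
  exists r', r' < r /\ S (fact r' k a v z).

Definition just (F : nat -> Prop) (l d r k a v z : nat) : Prop :=
  (k = 0 /\ (p1 a = 0 \/ 6 < p1 a) /\ z = 0) \/
  (k = 0 /\ p1 a = 1 /\ z = S (hdc v)) \/
  (k = 0 /\ p1 a = 2 /\ z = hdc (Nat.iter (p2 a) tlc v)) \/
  (k = 0 /\ p1 a = 3 /\ hdc v < l /\
     ((bit d (hdc v) /\ z = 1) \/ (~ bit d (hdc v) /\ z = 0))) \/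
  (k = 0 /\ p1 a = 4 /\ exists ys,
     mem F r 1 (p2 (p2 a)) v ys /\ mem F r 0 (p1 (p2 a)) ys z) \/
  (k = 0 /\ p1 a = 5 /\ hdc v = 0 /\ mem F r 0 (p1 (p2 a)) (tlc v) z) \/
  (k = 0 /\ p1 a = 5 /\ exists n y, hdc v = S n /\ mem F r 0 a (consc n (tlc v)) y /\
     mem F r 0 (p2 (p2 a)) (consc n (consc y (tlc v))) z) \/
  (k = 0 /\ p1 a = 6 /\ mem F r 0 (p2 a) (consc z v) 0 /\
     forall m, m < z -> exists x, mem F r 0 (p2 a) (consc m v) (S x)) \/
  (k = 1 /\ a = 0 /\ z = 0) \/
  (k = 1 /\ exists m y ys, a = S m /\ z = consc y ys /\
     mem F r 0 (p1 m) v y /\ mem F r 1 (p2 m) v ys).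

Definition valid (F : nat -> Prop) (l d : nat) : Prop :=
  forall r k a v z, F (fact r k a v z) -> just F l d r k a v z.

Lemma valid_sound X F l : valid F l (res X l) -> forall r k a v z, F (fact r k a v z) ->
  (k = 0 -> ev X (decode a) (ll v) z) /\ (k = 1 -> evl X (decodel a) (ll v) (ll z)).
Proof.
  intros HF. induction r as [r IH] using lt_wf_ind. intros k a v z H.
  assert (M0 : forall a v z, mem F r 0 a v z -> ev X (decode a) (ll v) z).
  { intros a' v' z' [r' [Hr Hf]]; apply (IH r' Hr 0 a' v' z'); auto. }
  assert (M1 : forall a v z, mem F r 1 a v z -> evl X (decodel a) (ll v) (ll z)).
  { intros a' v' z' [r' [Hr Hf]]; apply (IH r' Hr 1 a' v' z'); auto. }
  apply HF in H. clear IH.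
  destruct H as [H|[H|[H|[H|[H|[H|[H|[H|[H|H]]]]]]]]]; destruct H as [-> H];
    (split; intro Hk; try discriminate Hk).
  - destruct H as [H ->]. rewrite decode_eq.
    destruct (p1 a) as [|[|[|[|[|[|[|t]]]]]]]; try lia; constructor.
  - destruct H as [E ->]. rewrite decode_eq, E, <- ll_hd. constructor.
  - destruct H as [E ->]. rewrite decode_eq, E, <- ll_nth. constructor.
  - destruct H as [E [Hl H]]. rewrite decode_eq, E. rewrite res_bit in H by auto.
    rewrite <- ll_hd in H. destruct H as [[? ->]|[? ->]]; constructor; auto.
  - destruct H as [E [ys [H1 H2]]]. rewrite decode_eq, E. econstructor; eauto.
  - destruct H as [E [H1 H2]]. rewrite decode_eq, E.
    apply evPrec0; rewrite ?ll_hd, ?ll_tl; auto.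
  - destruct H as [E [n [y [H0 [H1 H2]]]]]. apply M0 in H1, H2.
    rewrite decode_eq, E in H1 |- *. rewrite !ll_cons, <- ?ll_tl in *.
    eapply evPrecS; eauto. rewrite ll_hd; auto.
  - destruct H as [E [H1 H2]]. rewrite decode_eq, E. apply evMu.
    + rewrite <- ll_cons; auto.
    + intros m Hm. destruct (H2 m Hm) as [x Hx]. exists x. rewrite <- ll_cons; auto.
  - destruct H as [-> ->]. constructor.
  - destruct H as [m [y [ys [-> [-> [H1 H2]]]]]]. rewrite decodel_S, ll_cons.
    constructor; auto.
Qed.

Lemma mem_mono (F G : nat -> Prop) r r' k a v z : (forall t, F t -> G t) -> r <= r' ->
  mem F r k a v z -> mem G r' k a v z.
Proof. intros H Hr [r0 [H0 H1]]; exists r0; split; auto; lia. Qed.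

Lemma just_mono X (F G : nat -> Prop) l l' r k a v z : (forall t, F t -> G t) -> l <= l' ->
  just F l (res X l) r k a v z -> just G l' (res X l') r k a v z.
Proof.
  intros HFG Hl H.
  assert (M : forall k a v z, mem F r k a v z -> mem G r k a v z).
  { intros; eapply mem_mono; eauto. }
  destruct H as [H|[H|[H|[H|[H|[H|[H|[H|[H|H]]]]]]]]].
  - left; auto.
  - right; left; auto.
  - do 2 right; left; auto.
  - do 3 right; left. destruct H as [-> [E [Hv H]]]. 
    rewrite (res_bit X l') by lia. rewrite (res_bit X l) in H by lia.
    repeat split; auto; lia.
  - do 4 right; left. destruct H as [-> [E [ys [H1 H2]]]].
    split; [auto|split; [auto|]]. exists ys; auto.
  - do 5 right; left. intuition.
  - do 6 right; left. destruct H as [-> [E [n [y [H0 [H1 H2]]]]]].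
    split; [auto|split; [auto|]]. exists n, y; auto.
  - do 7 right; left. destruct H as [-> [E [H1 H2]]]. repeat split; auto.
    intros m Hm; destruct (H2 m Hm) as [x Hx]; eauto.
  - do 8 right; left; auto.
  - do 9 right. destruct H as [-> [m [y [ys [-> [-> [H1 H2]]]]]]]. split; auto. exists m, y, ys; auto.
Qed.

Definition good X (F : nat -> Prop) (l : nat) : Prop :=
  (exists b, forall t, F t -> t < b) /\ valid F l (res X l).

Definition der X (k a v z : nat) : Prop :=
  exists F l r, good X F l /\ mem F r k a v z.

Lemma good_union X F G l l' : good X F l -> good X G l' ->
  good X (fun t => F t \/ G t) (max l l').
Proof.
  intros [[b Hb] HF] [[b' Hb'] HG]. split.
  - exists (b + b'). intros t [H|H]; [apply Hb in H|apply Hb' in H]; lia.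
  - intros r k a v z [H|H].
    + apply (just_mono X F _ l); auto; lia.
    + apply (just_mono X G _ l'); auto; lia.
Qed.

Lemma der_merge X k a v z k' a' v' z' : der X k a v z -> der X k' a' v' z' ->
  exists F l r, good X F l /\ mem F r k a v z /\ mem F r k' a' v' z'.
Proof.
  intros [F [l [r [H1 H2]]]] [G [l' [r' [H1' H2']]]].
  exists (fun t => F t \/ G t), (max l l'), (max r r'). split; [apply good_union; auto|].
  split; [apply (mem_mono F _ r)|apply (mem_mono G _ r')]; auto; lia.
Qed.

(** The new fact gets rank [r], above the ranks of its premises, and so occurs below rank [S r]. *)
Lemma der_step X F l r k a v z : good X F l -> just F l (res X l) r k a v z ->
  der X k a v z.
Proof.
  intros [[b Hb] HF] HJ.
  exists (fun t => F t \/ t = fact r k a v z), l, (S r). split; [split|].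
  - exists (b + S (fact r k a v z)). intros t [H| ->]; [apply Hb in H|]; lia.
  - intros r' k' a' v' z' H.
    assert (just F l (res X l) r' k' a' v' z') as HJ'.
    { destruct H as [H|H]; auto. apply fact_inj in H.
      destruct H as [-> [-> [-> [-> ->]]]]; auto. }
    eapply just_mono; [| |exact HJ']; auto.
  - exists r; split; auto.
Qed.

(** Serves the minimization rule, which has a premise for each smaller argument; the derivations are
    merged one at a time. *)
Lemma der_merge_family X k a (w y : nat -> nat) n : (forall m, m < n -> exists x, der X k a (w m) (y x)) ->
  exists F l r, good X F l /\ forall m, m < n -> exists x, mem F r k a (w m) (y x).
Proof.
  induction n as [|n IH]; intro H.
  - exists (fun _ => False), 0, 0. split; [|intros; lia].
    split; [exists 0; tauto|intros r k' a' v z []].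
  - destruct IH as [F [l [r [H1 H2]]]]; [intros; apply H; lia|].
    destruct (H n) as [x [G [l' [r' [H1' H2']]]]]; [lia|].
    exists (fun t => F t \/ G t), (max l l'), (max r r'). split; [apply good_union; auto|].
    intros m Hm. destruct (Nat.eq_dec m n) as [->|Hn].
    + exists x. apply (mem_mono G _ r'); auto; lia.
    + destruct (H2 m) as [x' Hx]; [lia|]. exists x'. apply (mem_mono F _ r); auto; lia.
Qed.

Lemma good_empty X l : good X (fun _ => False) l.
Proof. split; [exists 0; tauto|intros r k a v z []]. Qed.

Lemma der_complete X p v z : ev X p v z ->
  forall a v', decode a = p -> ll v' = v -> der X 0 a v' z.
Proof.
  revert p v z.
  apply (ev_nested_ind X (fun p v z => forall a v', decode a = p -> ll v' = v -> der X 0 a v' z)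
    (fun gs v ys => forall a v' ys', decodel a = gs -> ll v' = v -> ll ys' = ys ->
       der X 1 a v' ys')).
  - intros v a v' E <-. apply (der_step X _ 0 0 _ _ _ _ (good_empty X 0)).
    left. rewrite decode_eq in E.
    destruct (p1 a) as [|[|[|[|[|[|[|t]]]]]]]; try discriminate E; split; auto; split; auto; lia.
  - intros v a v' E <-. apply (der_step X _ 0 0 _ _ _ _ (good_empty X 0)).
    right; left. rewrite decode_eq in E. rewrite ll_hd.
    destruct (p1 a) as [|[|[|[|[|[|[|t]]]]]]]; try discriminate E; auto.
  - intros i v a v' E <-. apply (der_step X _ 0 0 _ _ _ _ (good_empty X 0)).
    do 2 right; left. rewrite decode_eq in E. rewrite ll_nth.
    destruct (p1 a) as [|[|[|[|[|[|[|t]]]]]]]; try discriminate E.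
    injection E as <-; auto.
  - intros v Hx a v' E <-.
    apply (der_step X _ (S (hdc v')) 0 _ _ _ _ (good_empty X (S (hdc v')))).
    do 3 right; left. rewrite decode_eq in E. rewrite ll_hd in Hx.
    destruct (p1 a) as [|[|[|[|[|[|[|t]]]]]]]; try discriminate E.
    rewrite res_bit by lia. auto 8.
  - intros v Hx a v' E <-.
    apply (der_step X _ (S (hdc v')) 0 _ _ _ _ (good_empty X (S (hdc v')))).
    do 3 right; left. rewrite decode_eq in E. rewrite ll_hd in Hx.
    destruct (p1 a) as [|[|[|[|[|[|[|t]]]]]]]; try discriminate E.
    rewrite res_bit by lia. auto 8.
  - intros f gs v ys z _ IH1 _ IH2 a v' E <-. rewrite decode_eq in E.
    destruct (ll_surj ys) as [ys' Hys].
    destruct (p1 a) as [|[|[|[|[|[|[|t]]]]]]] eqn:Ea; try discriminate E.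
    injection E as E1 E2.
    destruct (der_merge X 1 (p2 (p2 a)) v' ys' 0 (p1 (p2 a)) ys' z) as [F [l [r [H1 [H2 H3]]]]];
      eauto.
    apply (der_step X F l r); auto. do 4 right; left.
    split; [auto|split; [auto|]]. exists ys'; auto.
  - intros f g v z H0 _ IH a v' E <-. rewrite decode_eq in E.
    destruct (p1 a) as [|[|[|[|[|[|[|t]]]]]]] eqn:Ea; try discriminate E.
    injection E as E1 E2. rewrite ll_hd in H0.
    destruct (IH (p1 (p2 a)) (tlc v')) as [F [l [r [H1 H2]]]]; auto.
    { rewrite ll_tl; auto. }
    apply (der_step X F l r); auto. do 5 right; left; auto.
  - intros f g v n y z H0 _ IH1 _ IH2 a v' E <-.
    pose proof E as E'. rewrite decode_eq in E.
    destruct (p1 a) as [|[|[|[|[|[|[|t]]]]]]] eqn:Ea; try discriminate E.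
    injection E as E1 E2. rewrite ll_hd in H0.
    destruct (der_merge X 0 a (consc n (tlc v')) y 0 (p2 (p2 a))
      (consc n (consc y (tlc v'))) z) as [F [l [r [H1 [H2 H3]]]]].
    { apply IH1; auto. rewrite ll_cons, ll_tl; auto. }
    { apply IH2; auto. rewrite !ll_cons, ll_tl; auto. }
    apply (der_step X F l r); auto. do 6 right; left.
    split; [auto|split; [auto|]]. exists n, y; auto.
  - intros f v n _ IH Hm a v' E <-. rewrite decode_eq in E.
    destruct (p1 a) as [|[|[|[|[|[|[|t]]]]]]] eqn:Ea; try discriminate E.
    injection E as E1.
    destruct (der_merge_family X 0 (p2 a) (fun m => consc m v') S n) as [F [l [r [H1 H2]]]].
    { intros m Hl. destruct (Hm m Hl) as [k [_ Hk]]. exists k. apply Hk; auto.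
      apply ll_cons. }
    destruct (IH (p2 a) (consc n v')) as [G [l' [r' [H1' H2']]]]; auto; [apply ll_cons|].
    apply (der_step X (fun t => F t \/ G t) (max l l') (max r r')).
    { apply good_union; auto. }
    do 7 right; left. repeat split; auto.
    + apply (mem_mono G _ r'); auto; lia.
    + intros m Hl. destruct (H2 m Hl) as [x Hx]. exists x.
      apply (mem_mono F _ r); auto; lia.
  - intros v a v' ys' E <- H. apply (der_step X _ 0 0 _ _ _ _ (good_empty X 0)).
    do 8 right; left. destruct a; [|rewrite decodel_S in E; discriminate].
    destruct ys'; [auto|rewrite ll_S in H; discriminate].
  - intros g gs v y ys _ IH1 _ IH2 a v' ys' E <- H.
    destruct a as [|m]; [discriminate|rewrite decodel_S in E]. injection E as E1 E2.
    destruct ys' as [|y']; [discriminate|]. rewrite ll_S in H. injection H as H1 H2.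
    destruct (der_merge X 0 (p1 m) v' y 1 (p2 m) v' (p2 y')) as [F [l [r [G1 [G2 G3]]]]]; auto.
    apply (der_step X F l r); auto. do 9 right. split; auto. exists m, y, (p2 y').
    repeat split; auto. unfold consc. rewrite <- H1, pr_eta; auto.
Qed.

Definition halts (X : nat -> Prop) (e x : nat) : Prop := exists z, ev X (decode e) [x] z.

Definition halts_within (e x l d : nat) : Prop :=
  exists D r z, (forall t, t < D -> bit D t ->
      just (bit D) l d (p1 t) (p1 (p2 t)) (p1 (p2 (p2 t)))
        (p1 (p2 (p2 (p2 t)))) (p2 (p2 (p2 (p2 t))))) /\
    bit D (fact r 0 e (consc x 0) z).

Lemma halts_within_spec X e x : halts X e x <-> exists l, halts_within e x l (res X l).
Proof.
  split.
  - intros [z H].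
    destruct (der_complete X _ _ _ H e (consc x 0)) as [F [l [r [[[b Hb] HF] [r' [_ HM]]]]]].
    { reflexivity. } { apply ll_cons. }
    exists l, (res F b), r', z.
    assert (E : bit (res F b) = F).
    { apply functional_extensionality; intro t; apply propositional_extensionality.
      rewrite res_spec. split; [tauto|auto]. }
    rewrite E. split; auto. intros t _ Ht. apply HF. unfold fact. rewrite !pr_eta; auto.
  - intros [l [D [r [z [HD H]]]]]. exists z.
    replace [x] with (ll (consc x 0)) by apply ll_cons.
    apply (valid_sound X (bit D) l) with (r := r) (k := 0); auto.
    intros r' k a v z' Hf. specialize (HD _ (bit_lt _ _ Hf) Hf). unfold fact in HD.
    repeat (rewrite ?p1_pr, ?p2_pr in HD). exact HD.
Qed.

(** In this form the relation is only seen to be c.e., since it quantifies over derivations and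
    intermediate values without bounds; [universal_kernel] makes it decidable. *)
Lemma sigma1_halts_within Y : sigma1 Y (fun w =>
  halts_within (p1 w) (p1 (p2 w)) (p1 (p2 (p2 w))) (p2 (p2 (p2 w)))).
Proof.
  unfold halts_within, just, mem, fact, consc.
  assert (Hh : comput Y hdc) by (unfold hdc; cs).
  assert (Ht : comput Y tlc) by (unfold tlc; cs).
  cs; try (apply comput_iter; cs).
Qed.

(** Oracle calls become the constant 0, the answer of the empty oracle; thus whatever [emptyset]
    computes is computed by every oracle. *)
Fixpoint strip (p : prog) : prog :=
  match p with
  | POracle => PZero
  | PComp f gs => PComp (strip f) (map strip gs)
  | PPrec f g => PPrec (strip f) (strip g)
  | PMu f => PMu (strip f)
  | p => p
  end.

Lemma ev_strip Y p v z : ev emptyset p v z -> ev Y (strip p) v z.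
Proof.
  revert p v z. apply (ev_nested_ind emptyset (fun p v z => ev Y (strip p) v z)
    (fun gs v ys => evl Y (map strip gs) v ys)); cbn; intros; try (econstructor; eauto; fail).
  - destruct H.
  - apply evMu; auto. intros m Hm. destruct (H1 m Hm) as [k [_ Hk]]; eauto.
Qed.

Lemma decid_empty Y R : decid emptyset R -> decid Y R.
Proof.
  intros [f [[p Hp] E]]. exists f; split; auto. exists (strip p).
  intro c; apply ev_strip, Hp.
Qed.

(** A stage [t] bounds both the number [l] of oracle bits and the witness [s] of the c.e. relation,
    which makes the kernel decidable. Truncating the mask to [l] bits recovers the approximation at
    [l] from the one at [t]. *)
Lemma universal_kernel : exists V : nat -> nat -> nat -> nat -> Prop,
  (forall X e x, halts X e x <-> exists l, V e x l (res X l)) /\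
  (forall Y f1 f2 f3 f4, comput Y f1 -> comput Y f2 -> comput Y f3 -> comput Y f4 ->
     decid Y (fun c => V (f1 c) (f2 c) (f3 c) (f4 c))).
Proof.
  destruct (sigma1_elim _ _ (sigma1_halts_within emptyset)) as [K [HK EK]].
  assert (EK' : forall e x l d, halts_within e x l d <-> exists s, K (pr e (pr x (pr l d))) s).
  { intros e x l d. rewrite <- EK. repeat rewrite ?p1_pr, ?p2_pr. tauto. }
  exists (fun e x t d => exists l, l < S t /\ exists s, s < S t /\
    K (pr e (pr x (pr l (res (bit d) l)))) s).
  split.
  - intros X e x. rewrite halts_within_spec. split.
    + intros [l [s Hs]%EK']. exists (max l s). exists l; split; [lia|].
      exists s; split; [lia|]. rewrite res_res by lia. auto.
    + intros [t [l [Hl [s [Hsl Hs]]]]]. exists l. apply EK'. exists s.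
      rewrite res_res in Hs by lia. auto.
  - intros Y f1 f2 f3 f4 H1 H2 H3 H4.
    apply decid_empty with (Y := Y) in HK.
    cs.
Qed.

(** * Oracles, jumps and compactness *)

Lemma set_ext (X Y : nat -> Prop) : (forall x, X x <-> Y x) -> X = Y.
Proof.
  intro H. apply functional_extensionality; intro; apply propositional_extensionality; auto.
Qed.

(* [halts_at e x l d]: computation [e] on [x] halts within [l] steps when its oracle
   queries below [l] are answered by the bits of [d]. *)
Definition halts_at : nat -> nat -> nat -> nat -> Prop :=
  proj1_sig (constructive_indefinite_description _ universal_kernel).

Lemma halts_at_spec X e x : halts X e x <-> exists l, halts_at e x l (res X l).
Proof. apply (proj2_sig (constructive_indefinite_description _ universal_kernel)). Qed.

Lemma decid_halts_at Y f1 f2 f3 f4 :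
  comput Y f1 -> comput Y f2 -> comput Y f3 -> comput Y f4 ->
  decid Y (fun c => halts_at (f1 c) (f2 c) (f3 c) (f4 c)).
Proof. apply (proj2_sig (constructive_indefinite_description _ universal_kernel)). Qed.

Ltac cs_more ::= first [apply comput_res | apply decid_halts_at].

Lemma sigma1_halts_oracle Y X f g : decid Y X -> comput Y f -> comput Y g ->
  sigma1 Y (fun c => halts X (f c) (g c)).
Proof.
  intros HX Hf Hg.
  apply (sigma1_ext Y (fun c => exists l, halts_at (f c) (g c) l (res X l))).
  - intro; symmetry; apply halts_at_spec.
  - cs.
Qed.

Lemma sigma1_program X P : sigma1 X P ->
  exists p, forall c, P c <-> exists z, ev X p [c] z.
Proof.
  intros [R [[f [Hf E]] HP]].
  assert (Hg : compL X (fun v => 1 - f (pr (nth 1 v 0) (nth 0 v 0)))).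
  { apply compL_sub; [apply compL_const|]. destruct Hf as [p Hp].
    destruct (compL_pr X (fun v => nth 1 v 0) (fun v => nth 0 v 0)) as [q Hq];
      try apply compL_nth.
    exists (PComp p [q]); intro v. econstructor; [repeat constructor; apply Hq|apply Hp]. }
  destruct Hg as [p Hp]. exists (PMu p). intro c. rewrite HP. split.
  - intros [s Hs].
    assert (Hmin : exists n, f (pr c n) <> 0 /\ forall m, m < n -> f (pr c m) = 0).
    { apply E in Hs. revert Hs. induction s as [s IH] using lt_wf_ind. intro Hs.
      destruct (classic (exists m, m < s /\ f (pr c m) <> 0)) as [[m [Hm Hz]]|Hno].
      - apply (IH m); auto.
      - exists s; split; auto. intros m Hm. apply NNPP; intro; apply Hno; eauto. }
    destruct Hmin as [n [Hn Hm]]. exists n. apply evMu.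
    + replace 0 with (1 - f (pr c n)) by lia. apply (Hp [n; c]).
    + intros m Hl. exists 0. replace 1 with (1 - f (pr c m)) by (rewrite Hm; auto).
      apply (Hp [m; c]).
  - intros [z H]. exists z. apply E. inversion H as [| | | | | | | |? ? ? H0 _]; subst.
    pose proof (ev_det _ _ _ _ H0 _ (Hp [z; c])). cbn [nth] in *. lia.
Qed.

Lemma sigma1_index X P : sigma1 X P -> exists e, forall c, P c <-> halts X e c.
Proof.
  intros [p Hp]%sigma1_program. exists (code p). intro c. unfold halts.
  rewrite decode_code. apply Hp.
Qed.

(** Halting with oracle [X] is searched for with oracle [Y], from which the approximations [res X l]
    are computable. *)
Lemma sigma1_oracle Y X P : decid Y X -> sigma1 X P -> sigma1 Y P.
Proof.
  intros HX [e He]%sigma1_index.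
  apply (sigma1_ext Y (fun c => halts X e c)); [intro; symmetry; apply He|].
  apply (sigma1_halts_oracle Y X (fun _ => e) (fun c => c)); cs.
Qed.

Lemma post X P : sigma1 X P -> sigma1 X (fun c => ~ P c) -> decid X P.
Proof.
  intros [R [HR ER]]%sigma1_elim [Q [HQ EQ]]%sigma1_elim.
  destruct (comput_mu X (fun c s => R c s \/ Q c s)) as [g [Hg Eg]].
  - cs.
  - intro c. destruct (classic (P c)) as [H|H].
    + apply ER in H as [s Hs]; eauto.
    + apply EQ in H as [s Hs]; eauto.
  - apply (decid_ext X (fun c => R c (g c))); [|cs].
    intro c; split; [intro H; apply ER; eauto|].
    intro H. destruct (Eg c) as [|H']; auto. destruct (proj2 (EQ c)); eauto.
Qed.

Lemma decid_oracle_trans Y X P : decid Y X -> decid X P -> decid Y P.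
Proof.
  intros HX HP. apply post; apply (sigma1_oracle Y X); auto; apply sigma1_dec; auto.
  apply decid_not; auto.
Qed.

Lemma decid_self X : decid X X.
Proof. apply (decid_oracle X (fun c => c)); cs. Qed.

Lemma computable_in_decid B X : computable_in B X <-> decid X B.
Proof.
  split.
  - intros [p Hp]. exists (fun c => if excluded_middle_informative (B c) then 1 else 0).
    split.
    + exists p. intro c. destruct (excluded_middle_informative _); apply Hp; auto.
    + intro c. destruct (excluded_middle_informative _); split; auto; lia.
  - intros [f [Hf E]].
    assert (comput X (fun c => 1 - (1 - f c))) as [p Hp] by cs.
    exists p. intro x. specialize (Hp x). split; intro H.
    + apply E in H. replace 1 with (1 - (1 - f x)) by lia. auto.
    + assert (f x = 0) as H0. { apply NNPP; intro H0; apply H, E; auto. }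
      rewrite H0 in Hp; auto.
Qed.

Definition const_code (c : nat) : nat :=
  nat_rec (fun _ => nat) (code PZero)
    (fun _ y => pr 4 (pr (code PSucc) (S (pr y 0)))) c.

Lemma const_code_spec X c v : ev X (decode (const_code c)) v c.
Proof.
  induction c as [|c IH].
  - change (const_code 0) with (code PZero). rewrite decode_code. constructor.
  - change (const_code (S c)) with (pr 4 (pr (code PSucc) (S (pr (const_code c) 0)))).
    rewrite decode_eq. repeat rewrite ?p1_pr, ?p2_pr. rewrite decodel_S, p1_pr, p2_pr, decode_code.
    econstructor; [repeat constructor; exact IH|]. apply (evSucc X [c]).
Qed.

(** As [jump] is the diagonal halting set, [c] is built into a program that ignores its own input:
    [p] composed with the constant program [const_code c]. *)
Lemma decid_jump X P : sigma1 X P -> decid (jump X) P.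
Proof.
  intros [p Hp]%sigma1_program.
  apply (decid_ext (jump X) (fun c =>
    jump X (pr 4 (pr (code p) (S (pr (const_code c) 0)))))).
  - intro c. rewrite Hp. unfold jump. set (x := pr 4 _).
    assert (E : exists q, decode x = PComp p [q] /\ ev X q [x] c).
    { exists (decode (const_code c)). split; [|apply const_code_spec].
      unfold x. rewrite decode_eq. repeat rewrite ?p1_pr, ?p2_pr.
      rewrite decodel_S, p1_pr, p2_pr, decode_code. reflexivity. }
    destruct E as [q [-> Hq]]. split; intros [z Hz]; exists z.
    + inversion Hz as [| | | | |? ? ? ys ? H1 H2| | |]; subst.
      inversion H1 as [|? ? ? y ys' H3 H4]; subst. inversion H4; subst.
      rewrite (ev_det _ _ _ _ H3 _ Hq) in H2. auto.
    + econstructor; [repeat constructor; eauto|auto].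
  - apply decid_oracle. cs. unfold const_code.
    apply (comput_rec _ (fun _ => code PZero)
      (fun _ _ y => pr 4 (pr (code PSucc) (S (pr y 0)))) (fun c => c)); cs.
Qed.

(** Compactness of Cantor space; [Bad] lists the forbidden initial segments by length and mask. *)
Lemma koenig (Bad : nat -> nat -> Prop) :
  (forall L, exists d, forall l, l <= L -> ~ Bad l (res (bit d) l)) ->
  exists Z, forall l, ~ Bad l (res Z l).
Proof.
  intro H.
  (* The first [n] bits of [d] begin arbitrarily long sequences without bad initial segments. *)
  set (ok := fun n d => forall L, n <= L -> exists d', res (bit d') n = res (bit d) n /\
      forall l, l <= L -> ~ Bad l (res (bit d') l)).
  assert (Hstep : forall n d, ok n d -> exists d', res (bit d') n = res (bit d) n /\ ok (S n) d').
  { intros n d Hd. apply NNPP; intro Hno.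
    assert (Hk : forall (b : bool), exists L, S n <= L /\ forall d',
       res (bit d') n = res (bit d) n -> (bit d' n <-> b = true) ->
       exists l, l <= L /\ Bad l (res (bit d') l)).
    { intro b. apply NNPP; intro Hb. apply Hno.
      set (d0 := res (fun x => x < n /\ bit d x \/ x = n /\ b = true) (S n)).
      exists d0. split.
      - apply res_ext. intros x Hx. unfold d0. rewrite res_bit by lia. intuition lia.
      - intros L HL. apply NNPP; intro Hx. apply Hb. exists L; split; auto.
        intros d' H1 H2. apply NNPP; intro H3. apply Hx. exists d'. split.
        + apply res_ext. intros x Hl. unfold d0. rewrite res_bit by lia.
          destruct (Nat.eq_dec x n) as [->|Hxn].
          * rewrite H2. intuition lia.
          * rewrite <- (res_bit (bit d') n), H1, res_bit by lia. intuition lia.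
        + intros l Hl Hbad. apply H3; eauto. }
    (* If both one-bit extensions failed, at levels [L1] and [L2], a good sequence up to [max L1 L2]
       could continue with neither bit. *)
    destruct (Hk true) as [L1 [HL1 K1]], (Hk false) as [L2 [HL2 K2]].
    destruct (Hd (max L1 L2)) as [d' [E Hd']]; [lia|].
    destruct (classic (bit d' n)) as [Hb|Hb].
    - destruct (K1 d' E) as [l [Hl HB]]; [tauto|]. apply (Hd' l); auto; lia.
    - destruct (K2 d' E) as [l [Hl HB]]; [split; [tauto|discriminate]|].
      apply (Hd' l); auto; lia. }
  set (next := fun n d => epsilon (inhabits 0) (fun d' =>
      res (bit d') n = res (bit d) n /\ ok (S n) d')).
  set (D := fix D n := match n with 0 => 0 | S n => next n (D n) end).
  assert (HD : forall n, ok n (D n)).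
  { induction n as [|n IH].
    - intros L _. destruct (H L) as [d Hd]. exists d; split; auto.
    - cbn [D]. unfold next. apply (epsilon_spec (inhabits 0) _ (Hstep n (D n) IH)). }
  assert (HE : forall n, res (bit (D (S n))) n = res (bit (D n)) n).
  { intro n. cbn [D]. unfold next. apply (epsilon_spec (inhabits 0) _ (Hstep n (D n) (HD n))). }
  assert (HB : forall n x, x < n -> (bit (D n) x <-> bit (D (S x)) x)).
  { intros n x Hx. induction Hx as [|n Hx IH]; [tauto|].
    rewrite <- IH, <- (res_bit (bit (D (S n))) n), HE, res_bit by lia. tauto. }
  exists (fun x => bit (D (S x)) x). intros l Hbad.
  destruct (HD l l) as [d' [E Hd']]; auto. apply (Hd' l); auto.
  rewrite E. replace (res (bit (D l)) l) with (res (fun x => bit (D (S x)) x) l); auto.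
  apply res_ext. intros x Hx. symmetry; apply HB; auto.
Qed.

(** * Basis theorems and codes of Scott sets *)

(** An effectively closed class when [W] is c.e.; the length accompanies the mask because a mask
    does not show its trailing zeros. *)
Definition cls (W : nat -> Prop) (N : nat -> Prop) : Prop :=
  forall l, ~ W (pr l (res N l)).

(* [conflict W D]: no member of [cls W] makes all computations indexed by [D] diverge. *)
Definition conflict (W : nat -> Prop) (D : nat) : Prop :=
  exists L, forall d, d < 2 ^ L -> exists l, l < S L /\
    (W (pr l (res (bit d) l)) \/
     exists i, bit D i /\ halts_at (p1 i) (p2 i) l (res (bit d) l)).

(** By compactness a conflict already shows at a finite level, so conflict is a c.e. event relative
    to an oracle that enumerates [W]. *)
Lemma conflict_spec W D : conflict W D <->
  forall N, cls W N -> exists i, bit D i /\ halts N (p1 i) (p2 i).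
Proof.
  split.
  - intros [L HL] N HN. destruct (HL (res N L) (res_lt N L)) as [l [Hl H]].
    rewrite res_res in H by lia. destruct H as [H|[i [Hi H]]].
    + destruct (HN l H).
    + exists i; split; auto. apply halts_at_spec; eauto.
  - intro H. apply NNPP; intro Hno.
    destruct (koenig (fun l y => W (pr l y) \/
      exists i, bit D i /\ halts_at (p1 i) (p2 i) l y)) as [Z HZ].
    + intro L. apply NNPP; intro HL. apply Hno. exists L. intros d Hd.
      apply NNPP; intro Hl. apply HL. exists d. intros l Hle Hb. apply Hl.
      exists l; split; auto; lia.
    + destruct (H Z) as [i [Hi Hh]].
      * intros l Hl. apply (HZ l); auto.
      * apply halts_at_spec in Hh as [l Hl]. apply (HZ l); eauto.
Qed.

Lemma conflict_mono W D D' : (forall i, bit D i -> bit D' i) -> conflict W D -> conflict W D'.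
Proof.
  rewrite !conflict_spec. intros H HD N HN. destruct (HD N HN) as [i [Hi Hh]]; eauto.
Qed.

(** Divergence is a closed condition, so demands that are compatible finitely many at a time can be
    met together. *)
Lemma conflict_limit W (C : nat -> Prop) : (forall n, ~ conflict W (res C n)) ->
  exists N, cls W N /\ forall i, C i -> ~ halts N (p1 i) (p2 i).
Proof.
  intro H.
  destruct (koenig (fun l y => W (pr l y) \/ exists i a, i < l /\ a <= l /\ C i /\
    halts_at (p1 i) (p2 i) a (res (bit y) a))) as [Z HZ].
  - intro L.
    assert (exists N, cls W N /\ forall i, i < L -> C i -> ~ halts N (p1 i) (p2 i))
      as [N [HN HC]].
    { apply NNPP; intro Hno. apply (H L), conflict_spec. intros N HN.
      apply NNPP; intro Hx. apply Hno. exists N; split; auto.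
      intros i Hi Hc Hh. apply Hx. exists i; split; auto. apply res_bit; auto. }
    exists (res N L). intros l Hl. rewrite res_res by lia.
    intros [Hw|[i [a [Hi [Ha [Hc Hh]]]]]]; [apply (HN l); auto|].
    apply (HC i); auto; [lia|]. apply halts_at_spec. exists a.
    rewrite res_res in Hh by lia. auto.
  - exists Z; split.
    + intros l Hl. apply (HZ l); auto.
    + intros i Hc Hh. apply halts_at_spec in Hh as [a Ha].
      apply (HZ (S (i + a))). right. exists i, a. repeat split; auto; try lia.
      rewrite res_res by lia. auto.
Qed.

Definition addb (d i : nat) : nat := res (fun x => bit d x \/ x = i) (S (d + i)).

Lemma addb_spec d i x : bit (addb d i) x <-> bit d x \/ x = i.
Proof.
  unfold addb. rewrite res_spec. split; [tauto|]. intro H; split; auto.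
  destruct H as [H| ->]; [apply bit_lt in H|]; lia.
Qed.

Lemma sigma1_conflict O W : sigma1 O W -> sigma1 O (conflict W).
Proof. intro HW. unfold conflict. cs. Qed.

Lemma not_conflict_0 W : (exists N, cls W N) -> ~ conflict W 0.
Proof.
  intros [N HN] H. rewrite conflict_spec in H. destruct (H N HN) as [i [Hi _]].
  unfold bit in Hi. rewrite Nat.bits_0 in Hi. discriminate.
Qed.

(** The low basis theorem of Jockusch and Soare: each computation in turn is made to diverge if the
    earlier decisions permit it. *)
Theorem low_basis O W : sigma1 O W -> (exists N, cls W N) ->
  exists N, cls W N /\ forall P, sigma1 N P -> decid (jump O) P.
Proof.
  intros HW Hne.
  set (Dm := fix Dm n := match n with 0 => 0 | S i =>
     if excluded_middle_informative (conflict W (addb (Dm i) i)) then Dm i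
     else addb (Dm i) i end).
  set (C := fun i => ~ conflict W (addb (Dm i) i)).
  assert (HD : forall n, Dm n = res C n /\ ~ conflict W (Dm n)).
  { induction n as [|n [IH1 IH2]]; [split; [auto|apply not_conflict_0; auto]|].
    cbn [Dm]. destruct (excluded_middle_informative _) as [Hc|Hc]; (split; [|auto]).
    - rewrite IH1. apply bit_ext; intro x. rewrite !res_spec. split.
      + intros [? ?]; split; auto.
      + intros [Hx HC]. destruct (Nat.eq_dec x n) as [->|]; [destruct (HC Hc)|].
        split; auto; lia.
    - apply bit_ext; intro x. rewrite addb_spec, IH1, !res_spec. split.
      + intros [[? ?]| ->]; split; auto.
      + intros [Hx HC]. destruct (Nat.eq_dec x n); auto. left; split; auto; lia. }
  destruct (conflict_limit W C) as [N [HN HC]].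
  { intro n. destruct (HD n) as [E H]. rewrite <- E; auto. }
  exists N; split; auto.
  (* An index left out of [C] conflicts with the earlier decisions, so it halts at every member of
     the class that respects them, in particular at [N]. *)
  assert (Hh : forall i, halts N (p1 i) (p2 i) <-> ~ C i).
  { intro i; split; [intros H Hc; apply (HC i); auto|]. intro H. apply NNPP in H.
    rewrite conflict_spec in H. destruct (H N HN) as [j [Hj Hh]].
    apply addb_spec in Hj as [Hj| ->]; auto.
    destruct (HD i) as [E _]. rewrite E in Hj. apply res_spec in Hj as [_ Hj].
    destruct (HC j Hj Hh). }
  assert (HCd : decid (jump O) C).
  { assert (HE := decid_jump _ _ (sigma1_conflict O W HW)).
    (* The mask [d] records the decisions up to [i]. Each depends only on the earlier ones, so
       exactly one mask is correct and a bounded search finds it. *)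
    apply (decid_ext (jump O) (fun i => exists d, d < 2 ^ S i /\
      (forall j, j < S i -> (bit d j <-> ~ conflict W (addb (res (bit d) j) j))) /\ bit d i)).
    - intro i. assert (E : forall j, C j <-> ~ conflict W (addb (res C j) j)).
      { intro j. unfold C at 1. destruct (HD j) as [-> _]. tauto. }
      split.
      + intros [d [_ [Hd Hi]]].
        assert (G : forall j, j < S i -> (bit d j <-> C j)).
        { induction j as [j IH] using lt_wf_ind. intro Hj. rewrite Hd, E by auto.
          rewrite (res_ext (bit d) C); [tauto|]. intros; apply IH; lia. }
        apply G; auto.
      + intro Hi. exists (res C (S i)). split; [apply res_lt|]. split.
        * intros j Hj. rewrite res_bit, res_res by lia. apply E.
        * apply res_bit; auto.
    - unfold addb. cs. }
  intros P [e He]%sigma1_index.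
  apply (decid_ext (jump O) (fun c => ~ C (pr e c))); [|cs].
  intro c. rewrite He, <- Hh, p1_pr, p2_pr. tauto.
Qed.

(** The set of [x] at which divergence of the [e]-th computation conflicts with the decisions so far
    is c.e. in [O], hence differs from [B]. A difference defeats [e]: it must halt at some [x]
    outside [B], or it can be made to diverge at some [x] in [B]. *)
Theorem avoidance_basis O W B : sigma1 O W -> (exists N, cls W N) -> ~ sigma1 O B ->
  exists N, cls W N /\ ~ sigma1 N B.
Proof.
  intros HW Hne HB.
  set (step := fun e D D' => (forall i, bit D i -> bit D' i) /\ ~ conflict W D' /\
    ((exists x, ~ B x /\ conflict W (addb D (pr e x))) \/ (exists x, B x /\ bit D' (pr e x)))).
  assert (Hstep : forall e D, ~ conflict W D -> exists D', step e D D').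
  { intros e D HD.
    assert (HS : sigma1 O (fun x => conflict W (addb D (pr e x)))).
    { pose proof (sigma1_conflict O W HW). unfold addb. cs. }
    apply NNPP; intro Hno. apply HB. eapply sigma1_ext; [|exact HS]. intro x; cbv beta. split.
    - intro Hc. apply NNPP; intro Hx. apply Hno. exists D. repeat split; eauto.
    - intro Hx. apply NNPP; intro Hc. apply Hno. exists (addb D (pr e x)). repeat split; auto.
      + intros; apply addb_spec; auto.
      + right. exists x; split; auto. apply addb_spec; auto. }
  set (D := fix D n := match n with 0 => 0 | S e => epsilon (inhabits 0) (step e (D e)) end).
  assert (HD : forall n, ~ conflict W (D n)).
  { induction n as [|n IH]; [apply not_conflict_0; auto|].
    apply (epsilon_spec (inhabits 0) _ (Hstep n (D n) IH)). }
  assert (HS : forall e, step e (D e) (D (S e))).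
  { intro e. apply (epsilon_spec (inhabits 0) _ (Hstep e (D e) (HD e))). }
  assert (Hmono : forall m n, m <= n -> forall i, bit (D m) i -> bit (D n) i).
  { induction 1; auto. intros i Hi. apply HS; auto. }
  destruct (conflict_limit W (fun i => exists n, bit (D n) i)) as [N [HN HC]].
  { intros n Hc.
    (* Only finitely many indices are below [n], so one stage [b] contains all of them that ever
       enter. *)
    destruct (collection n (fun i m => bit (D m) i \/ forall m, ~ bit (D m) i)) as [b Hb].
    { intros i _. destruct (classic (exists m, bit (D m) i)) as [[m Hm]|Hm]; eauto.
      exists 0; right; intros m Hx; apply Hm; eauto. }
    apply (HD b). eapply conflict_mono; [|exact Hc].
    intros i [Hi [m Hm]]%res_spec. destruct (Hb i Hi) as [k [Hk [H|H]]].
    - apply (Hmono k); auto; lia.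
    - destruct (H m Hm). }
  exists N; split; auto. intros [e He]%sigma1_index.
  destruct (HS e) as [_ [_ [[x [Hx Hc]]|[x [Hx Hb]]]]].
  - apply Hx, He. rewrite conflict_spec in Hc. destruct (Hc N HN) as [i [Hi Hh]].
    apply addb_spec in Hi as [Hi| ->].
    + destruct (HC i); eauto.
    + rewrite p1_pr, p2_pr in Hh; auto.
  - apply (HC (pr e x)); [eauto|]. rewrite p1_pr, p2_pr. apply He; auto.
Qed.

(** * Scott sets coded by columns *)

Definition below (N : nat -> Prop) (j : nat) : nat -> Prop := fun x => N x /\ p1 x < j.
Definition col (N : nat -> Prop) (c : nat) : nat -> Prop := fun x => N (pr c x).

(** Column 0 holds the base set. Column [S (pr e j)] is reserved for a member of the closed class
    given by [e] relative to the first [j] columns; it comes after them because [j <= pr e j]. *)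
Definition scott (O N : nat -> Prop) : Prop :=
  (forall x, N (pr 0 x) <-> O x) /\
  forall e j, (exists Z, forall l, ~ halts (below N j) e (pr l (res Z l))) ->
    forall l, ~ halts (below N j) e (pr l (res (col N (S (pr e j))) l)).

Definition survives (e : nat) (Y Z : nat -> Prop) (L : nat) : Prop :=
  forall a, a < S L -> forall b, b < S L -> ~ halts_at e (pr a (res Z a)) b (res Y b).

Lemma survives_ext e Y Y' Z Z' L : (forall x, x < L -> (Y x <-> Y' x)) ->
  (forall x, x < L -> (Z x <-> Z' x)) -> survives e Y Z L -> survives e Y' Z' L.
Proof.
  intros HY HZ H a Ha b Hb. rewrite <- (res_ext Y Y'), <- (res_ext Z Z'); auto.
  - intros; apply HZ; lia.
  - intros; apply HY; lia.
Qed.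

Lemma survives_mono e Y Z L L' : L' <= L -> survives e Y Z L -> survives e Y Z L'.
Proof. intros HL H a Ha b Hb; apply H; lia. Qed.

Lemma survives_all e Y Z :
  (forall L, survives e Y Z L) <-> forall l, ~ halts Y e (pr l (res Z l)).
Proof.
  split.
  - intros H l Hh. apply halts_at_spec in Hh as [b Hb]. apply (H (l + b) l) with b; auto; lia.
  - intros H L a Ha b Hb Hh. apply (H a), halts_at_spec; eauto.
Qed.

(** If the tree is infinite, [Z] is a path; otherwise it survives to the greatest possible level.
    One set thus serves all levels at once. *)
Lemma best_survivor e Y : exists Z, forall L,
  (exists d, survives e Y (bit d) L) -> survives e Y Z L.
Proof.
  destruct (classic (forall L, exists d, survives e Y (bit d) L)) as [H|H].
  - destruct (koenig (fun l y => exists a b, a <= l /\ b <= l /\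
      halts_at e (pr a (res (bit y) a)) b (res Y b))) as [Z HZ].
    + intro L. destruct (H L) as [d Hd]. exists d. intros l Hl [a [b [Ha [Hb Hh]]]].
      apply (Hd a) with b; try lia.
      rewrite (res_ext (bit d) (bit (res (bit d) l))); auto.
      intros x Hx. rewrite res_bit by lia. tauto.
    + exists Z. intros L _ a Ha b Hb Hh. apply (HZ L). exists a, b.
      rewrite res_res by lia. repeat split; auto; lia.
  - apply not_all_ex_not in H as [L HL]. induction L as [|L IH].
    + exists (fun _ => False). intros L [d Hd]. destruct HL. exists d.
      eapply survives_mono; [|exact Hd]; lia.
    + destruct (classic (exists d, survives e Y (bit d) L)) as [[d Hd]|Hn]; auto.
      exists (bit d). intros L' [d' Hd']. apply (survives_mono e Y _ L); auto.
      destruct (le_lt_dec L' L); auto. destruct HL. exists d'.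
      eapply survives_mono; [|exact Hd']; lia.
Qed.

(** The demand on a column is made level by level, even if the tree turns out to be finite. This
    makes it a closed condition on [N], so that the basis theorems apply, while the premise in
    [scott] is infinitary. *)
Definition scott_at (N : nat -> Prop) (e j L : nat) : Prop :=
  (exists d, d < 2 ^ L /\ survives e (below N j) (bit d) L) ->
  survives e (below N j) (col N (S (pr e j))) L.

Lemma scott_at_ext N N' e j L : (forall x, x <= pr (S (pr e j)) L -> (N x <-> N' x)) ->
  scott_at N e j L -> scott_at N' e j L.
Proof.
  intros HN H [d [Hd Hs]].
  assert (HL := pr_ge2 (S (pr e j)) L).
  assert (E : forall x, x < L -> (below N j x <-> below N' j x)).
  { intros x Hx. unfold below. rewrite HN by lia. tauto. }
  apply (survives_ext e (below N j) _ (col N (S (pr e j)))); auto.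
  - intros x Hx. unfold col. apply HN. apply pr_mono; lia.
  - apply H. exists d; split; auto. apply (survives_ext e (below N' j) _ (bit d)); auto.
    + intros; symmetry; apply E; auto.
    + tauto.
Qed.

Definition scott_bad (O : nat -> Prop) (w : nat) : Prop :=
  (exists x, pr 0 x < p1 w /\ ~ (bit (p2 w) (pr 0 x) <-> O x)) \/
  (exists e j L, pr (S (pr e j)) L < p1 w /\ ~ scott_at (bit (p2 w)) e j L).

Lemma sigma1_scott_bad O : sigma1 O (scott_bad O).
Proof.
  unfold scott_bad, scott_at, survives, below, col.
  pose proof (decid_self O). cs.
Qed.

Lemma scott_cls O N : cls (scott_bad O) N -> scott O N.
Proof.
  intro H. split.
  - intro x. apply NNPP; intro Hx. apply (H (S (pr 0 x))). left. exists x.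
    rewrite p1_pr, p2_pr, res_bit by lia. split; auto.
  - intros e j [Z HZ]. apply survives_all. intro L. pose proof (proj2 (survives_all _ _ _) HZ) as HZ'.
    apply NNPP; intro Hn. apply (H (S (pr (S (pr e j)) L))). right. exists e, j, L.
    rewrite p1_pr, p2_pr. split; auto. intro Hs.
    apply (scott_at_ext _ N) in Hs.
    + apply Hn, Hs. exists (res Z L). split; [apply res_lt|].
      apply (survives_ext e (below N j) _ Z); auto; [tauto|].
      intros; rewrite res_bit by lia; tauto.
    + intros x Hx. apply res_bit; lia.
Qed.

(** Column [S m] consults only the first [p2 m] columns and [p2 m <= m], so the columns are chosen
    one after another; [prev c] collects those before [c]. *)
Lemma scott_nonempty O : exists N, cls (scott_bad O) N.
Proof.
  set (pick := fun e Y => proj1_sig (constructive_indefinite_description _ (best_survivor e Y))).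
  set (new := fun c (Y : nat -> Prop) => match c with 0 => O | S m =>
      pick (p1 m) (below Y (p2 m)) end).
  set (prev := fix prev c : nat -> Prop := match c with 0 => fun _ => False
     | S c => fun w => prev c w \/ (p1 w = c /\ new c (prev c) (p2 w)) end).
  set (N := fun w => prev (S (p1 w)) w).
  assert (Hprev : forall c w, prev (S c) w <->
    prev c w \/ (p1 w = c /\ new c (prev c) (p2 w))) by reflexivity.
  assert (Hlt : forall c w, prev c w -> p1 w < c).
  { induction c as [|c IH]; cbn; [tauto|]. intros w [H|[H _]]; [apply IH in H|]; lia. }
  assert (HN : forall c w, p1 w < c -> (prev c w <-> N w)).
  { intros c w Hw. unfold N. induction Hw as [|c Hw IH]; [tauto|].
    rewrite <- IH. cbn [prev]. split; auto. intros [H|[H _]]; auto; lia. }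
  assert (Hcol : forall m, col N (S m) = pick (p1 m) (below N (p2 m))).
  { intro m. apply set_ext. intro x. unfold col.
    assert (E : below N (p2 m) = below (prev (S m)) (p2 m)).
    { apply set_ext. intro y. unfold below. pose proof (p2_le m).
      split; intros [H1 H2]; split; auto; apply (HN (S m)); auto; lia. }
    rewrite E. unfold N. rewrite p1_pr, Hprev, p1_pr, p2_pr. split.
    - intros [H|[_ H]]; auto. apply Hlt in H. rewrite p1_pr in H; lia.
    - intro H; right; auto. }
  assert (Hs : forall e j L, scott_at N e j L).
  { intros e j L [d [_ Hd]]. rewrite Hcol, p1_pr, p2_pr. unfold pick.
    destruct (constructive_indefinite_description _ _) as [Z HZ]; cbn. apply HZ; eauto. }
  exists N. intros l [[x [Hx Hb]]|[e [j [L [Hl Hb]]]]]; rewrite p1_pr in *; rewrite p2_pr in *.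
  - apply Hb. rewrite res_bit by auto. unfold N. rewrite p1_pr, Hprev, p1_pr, p2_pr.
    cbn [prev new]. tauto.
  - apply Hb. apply (scott_at_ext N); auto. intros x Hx. symmetry; apply res_bit; lia.
Qed.

Corollary low_scott O : exists N, scott O N /\ forall P, sigma1 N P -> decid (jump O) P.
Proof.
  destruct (low_basis O _ (sigma1_scott_bad O) (scott_nonempty O)) as [N [HN HL]].
  exists N; split; auto. apply scott_cls; auto.
Qed.

Corollary avoiding_scott O B : ~ sigma1 O B -> exists N, scott O N /\ ~ sigma1 N B.
Proof.
  intro HB. destruct (avoidance_basis O _ B (sigma1_scott_bad O) (scott_nonempty O) HB)
    as [N [HN HL]]. exists N; split; auto. apply scott_cls; auto.
Qed.

(** * Ultrafilters on Scott sets and partition regular classes *)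

(* The Scott ideal coded by [N]: [inM N] are its members, [re N] the sets c.e. in a member. *)
Definition inM (N Y : nat -> Prop) : Prop := exists c, Y = col N c.
Definition re (N : nat -> Prop) (P : nat -> Prop) : Prop := exists j, sigma1 (below N j) P.

Lemma decid_below N j : decid N (below N j).
Proof. unfold below. pose proof (decid_self N). cs. Qed.

Lemma decid_below_le N j j' : j <= j' -> decid (below N j') (below N j).
Proof.
  intro H. apply (decid_ext _ (fun x => below N j' x /\ p1 x < j)).
  - intro x; unfold below; intuition lia.
  - pose proof (decid_self (below N j')). cs.
Qed.

Lemma decid_col N c j : c < j -> decid (below N j) (col N c).
Proof.
  intro H. apply (decid_ext _ (fun x => below N j (pr c x))).
  - intro x; unfold below, col; rewrite p1_pr; tauto.
  - pose proof (decid_self (below N j)). cs.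
Qed.

Lemma decid_col_self N c : decid N (col N c).
Proof. unfold col. pose proof (decid_self N). cs. Qed.

Lemma sigma1_below_le N j j' P : j <= j' -> sigma1 (below N j) P -> sigma1 (below N j') P.
Proof. intro H; apply sigma1_oracle, decid_below_le; auto. Qed.

Lemma re_sigma1 N P : re N P -> sigma1 N P.
Proof. intros [j H]. eapply sigma1_oracle; [|exact H]. apply decid_below. Qed.

Lemma re_common N P Q X : re N P -> re N Q -> inM N X ->
  exists j, sigma1 (below N j) P /\ sigma1 (below N j) Q /\ decid (below N j) X.
Proof.
  intros [j HP] [k HQ] [c ->]. exists (S (j + k + c)). repeat split.
  - apply (sigma1_below_le N j); auto; lia.
  - apply (sigma1_below_le N k); auto; lia.
  - apply decid_col; lia.
Qed.

Lemma scott_zero O N : scott O N -> col N 0 = O.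
Proof. intros [H _]. apply set_ext; auto. Qed.

Lemma scott_base O N : scott O N -> decid (below N 1) O.
Proof. intro H. rewrite <- (scott_zero O N H). apply decid_col; auto. Qed.

Lemma scott_re O N P : scott O N -> sigma1 O P -> re N P.
Proof. intros H HP. exists 1. eapply sigma1_oracle; [|exact HP]. apply scott_base; auto. Qed.

Lemma scott_member O N W : scott O N -> re N W -> (exists Z, cls W Z) ->
  exists Z, inM N Z /\ cls W Z.
Proof.
  intros [_ H] [j [e He]%sigma1_index] [Z HZ].
  exists (col N (S (pr e j))). split; [eexists; reflexivity|].
  intros l Hl. apply He in Hl. revert Hl. apply H.
  exists Z. intros l' Hl'. apply He in Hl'. apply (HZ l'); auto.
Qed.

(** The singleton of [Y] is an effectively closed class relative to the ideal, so its only member is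
    a column. *)
Lemma scott_closed O N j Y : scott O N -> decid (below N j) Y -> inM N Y.
Proof.
  intros HN HY.
  destruct (scott_member O N (fun w => exists x, x < p1 w /\ ~ (bit (p2 w) x <-> Y x)) HN)
    as [Z [HZ HW]].
  - exists j. cs.
  - exists Y. intros l [x [Hx Hb]]. rewrite p1_pr in Hx. rewrite p2_pr, res_bit in Hb; tauto.
  - replace Y with Z; auto. apply set_ext. intro x. apply NNPP; intro Hx.
    apply (HW (S x)). exists x. rewrite p1_pr, p2_pr, res_bit by lia. auto.
Qed.

Lemma inM_and O N X Y : scott O N -> inM N X -> inM N Y -> inM N (fun x => X x /\ Y x).
Proof.
  intros HN [a ->] [b ->]. apply (scott_closed O N (S (a + b))); auto.
  apply decid_and; apply decid_col; lia.
Qed.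

Lemma inM_diff O N X Y : scott O N -> inM N X -> inM N Y -> inM N (fun x => X x /\ ~ Y x).
Proof.
  intros HN [a ->] [b ->]. apply (scott_closed O N (S (a + b))); auto.
  apply decid_and; [|apply decid_not]; apply decid_col; lia.
Qed.

Lemma inM_full O N : scott O N -> inM N (fun _ => True).
Proof. intro HN. apply (scott_closed O N 0); auto. apply decid_const. Qed.

(** * Open upward closed classes and splittings *)

Definition fsub (D : nat) (Y : nat -> Prop) : Prop := forall y, y < D -> bit D y -> Y y.
Definition up (Q : nat -> Prop) (Y : nat -> Prop) : Prop := exists D, fsub D Y /\ Q D.

Lemma up_mono Q (Y Z : nat -> Prop) : (forall x, Y x -> Z x) -> up Q Y -> up Q Z.
Proof. intros H [D [HD HQ]]; exists D; split; auto. intros y Hy Hb; auto. Qed.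

Lemma fsub_res (Y : nat -> Prop) l : fsub (res Y l) Y.
Proof. intros y _ [_ H]%res_spec; auto. Qed.

(* The members of [up (part Q0 Q1)] are the sets each of whose two-part splittings
   has its first part in [up Q0] or its second part in [up Q1]. *)
Definition part (Q0 Q1 : nat -> Prop) (D : nat) : Prop :=
  forall d, d < 2 ^ D -> up Q0 (fun y => bit D y /\ bit d y) \/
                         up Q1 (fun y => bit D y /\ ~ bit d y).

(** Splittings form a compact space, so if all splittings of [Y] fall into one of the two classes, a
    finite subset of [Y] already ensures it. *)
Lemma part_spec Q0 Q1 Y : up (part Q0 Q1) Y <->
  forall Z, up Q0 (fun y => Y y /\ Z y) \/ up Q1 (fun y => Y y /\ ~ Z y).
Proof.
  split.
  - intros [D [HD HP]] Z. destruct (HP (res Z D) (res_lt Z D)) as [H|H]; [left|right];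
      (eapply up_mono; [|exact H]); intros y [H1 H2]; pose proof (bit_lt _ _ H1);
      rewrite res_bit in H2 by auto; auto.
  - intro H. apply NNPP; intro Hno.
    destruct (koenig (fun l y => up Q0 (fun t => t < l /\ Y t /\ bit y t) \/
       up Q1 (fun t => t < l /\ Y t /\ ~ bit y t))) as [Z HZ].
    + intro L. apply NNPP; intro HL. apply Hno. exists (res Y L). split; [apply fsub_res|].
      intros d _. apply NNPP; intro Hd. apply HL. exists d. intros l Hl Hb. apply Hd.
      destruct Hb as [Hb|Hb]; [left|right]; (eapply up_mono; [|exact Hb]); intros t [H1 [H2 H3]];
        rewrite res_bit in H3 by auto; (split; [apply res_spec; split; auto; lia|auto]).
    + destruct (H Z) as [[D [HD HQ]]|[D [HD HQ]]]; apply (HZ D); [left|right];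
        exists D; (split; [|auto]); intros y Hy Hb; destruct (HD y Hy Hb);
        rewrite res_bit by auto; auto.
Qed.

Lemma sigma1_part Y Q0 Q1 : sigma1 Y (fun w => Q0 (p1 w) (p2 w)) ->
  sigma1 Y (fun w => Q1 (p1 w) (p2 w)) ->
  sigma1 Y (fun w => part (Q0 (p1 w)) (Q1 (p1 w)) (p2 w)).
Proof. intros. unfold part, up, fsub. cs. Qed.

Lemma sigma1_up Y Q X : sigma1 Y (fun w => Q (p1 w) (p2 w)) ->
  decid Y (fun w => X (p1 w) (p2 w)) -> sigma1 Y (fun c => up (Q c) (X c)).
Proof. intros. unfold up, fsub. cs. Qed.

(** Avoiding both classes is an effectively closed condition on the splitting, so the Scott property
    supplies one in the ideal. *)
Lemma part_member O N Q0 Q1 X : scott O N -> inM N X -> re N Q0 -> re N Q1 ->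
  ~ up (part Q0 Q1) X -> exists Z, inM N Z /\ ~ up Q0 (fun y => X y /\ Z y) /\
    ~ up Q1 (fun y => X y /\ ~ Z y).
Proof.
  intros HN HX H0 H1 Hno.
  destruct (re_common N Q0 Q1 X H0 H1 HX) as [j [K0 [K1 KX]]].
  destruct (scott_member O N (fun w =>
     up Q0 (fun t => t < p1 w /\ X t /\ bit (p2 w) t) \/
     up Q1 (fun t => t < p1 w /\ X t /\ ~ bit (p2 w) t)) HN) as [Z [HZ HW]].
  - exists j. unfold up, fsub. cs.
  - apply NNPP; intro Hn. apply Hno, part_spec. intro Z. apply NNPP; intro HZ.
    apply Hn. exists Z. intros l Hl. apply HZ. rewrite p1_pr, p2_pr in Hl.
    destruct Hl as [Hl|Hl]; [left|right]; (eapply up_mono; [|exact Hl]);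
      intros t [A1 [A2 A3]]; rewrite res_bit in A3 by auto; auto.
  - exists Z; split; auto.
    split; intros [D [HD HQ]]; apply (HW D); rewrite p1_pr, p2_pr; [left|right];
      exists D; (split; [|auto]); intros y Hy Hb; destruct (HD y Hy Hb);
      rewrite res_bit by auto; auto.
Qed.

(** The last field presents the class as an intersection of open classes uniformly c.e. in a member
    of the ideal; this bound on its complexity allows an ultrafilter inside it to be found one level
    up. *)
Record large (N : nat -> Prop) (P : (nat -> Prop) -> Prop) : Prop := {
  large_up : forall Y Z : nat -> Prop, (forall x, Y x -> Z x) -> P Y -> P Z;
  large_inf : forall Y, P Y -> infinite Y;
  large_full : P (fun _ => True);
  large_part : forall Y Z : nat -> Prop, P Y ->
    P (fun x => Y x /\ Z x) \/ P (fun x => Y x /\ ~ Z x);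
  large_def : exists R, re N R /\ forall Y, P Y <-> forall e, up (fun D => R (pr e D)) Y }.

Lemma large_infinite N : large N infinite.
Proof.
  split.
  - intros Y Z H HY m. destruct (HY m) as [x [? ?]]; eauto.
  - auto.
  - intro m; exists m; auto.
  - intros Y Z HY. apply NNPP; intro H. apply not_or_and in H as [H1 H2].
    apply not_all_ex_not in H1 as [a Ha]. apply not_all_ex_not in H2 as [b Hb].
    destruct (HY (max a b)) as [x [Hx Hy]]. destruct (classic (Z x)).
    + apply Ha. exists x. split; auto; lia.
    + apply Hb. exists x. split; auto; lia.
  - exists (fun w => exists x, p1 w <= x /\ bit (p2 w) x). split; [exists 0; cs|].
    intro Y; split.
    + intros HY e. destruct (HY e) as [x [Hx Hy]]. exists (res (fun y => y = x) (S x)). split.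
      * intros y _ [_ ->]%res_spec; auto.
      * rewrite p1_pr, p2_pr. exists x; split; auto. apply res_bit; auto.
    + intros H e. destruct (H e) as [D [HD [x [Hx Hb]]]]. rewrite p1_pr in Hx.
      rewrite p2_pr in Hb. exists x; split; auto. apply HD; auto. apply bit_lt; auto.
Qed.

(** The piece selected by [I] in the partition generated by the first [L] columns. *)
Definition cell (N I : nat -> Prop) (L : nat) : nat -> Prop :=
  fun x => forall i, i < L -> (I i <-> N (pr i x)).

(* [I] indexes an ultrafilter, contained in [P], on the columns of [N]. *)
Definition ultra (N : nat -> Prop) (P : (nat -> Prop) -> Prop) (I : nat -> Prop) : Prop :=
  forall L, P (cell N I L).

Lemma cell_ext N I J L : (forall i, i < L -> (I i <-> J i)) -> cell N I L = cell N J L.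
Proof.
  intro H. apply set_ext. intro x; split; intros Hc i Hi; [rewrite <- H|rewrite H]; auto.
Qed.

(** * From one Scott set to the next *)

Section Step.
Variables (O N N' : nat -> Prop) (P : (nat -> Prop) -> Prop).
Hypothesis HN : scott O N.
Hypothesis Hlow : forall Q, sigma1 N Q -> decid (jump O) Q.
Hypothesis HN' : scott (jump O) N'.
Hypothesis HP : large N P.

(** By lowness [jump O] decides whether a cell lies in the [e]-th open class defining [P]. So the
    [I] with all cells in [P] form an effectively closed class over [jump O], nonempty by partition
    regularity and compactness, and [N'] contains a member. *)
Lemma ultra_exists : exists I, inM N' I /\ ultra N P I.
Proof.
  destruct (large_def N P HP) as [R [HR ER]].
  assert (HD : decid (jump O) (fun w => up (fun D => R (pr (p2 w) D))
     (cell N (bit (p2 (p1 w))) (p1 (p1 w))))).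
  { apply Hlow. apply re_sigma1 in HR. pose proof (decid_self N). unfold cell, up, fsub. cs. }
  destruct (scott_member (jump O) N' (fun w => exists e, ~ up (fun D => R (pr e D))
     (cell N (bit (p2 w)) (p1 w))) HN') as [I [HI HC]].
  - apply (scott_re (jump O)); auto. apply sigma1_ex, sigma1_dec, decid_not. exact HD.
  - destruct (koenig (fun l y => ~ P (cell N (bit y) l))) as [Z HZ].
    + intro L. assert (exists d, P (cell N (bit d) L)) as [d Hd].
      { induction L as [|L [d Hd]].
        - exists 0. eapply (large_up N P HP); [|apply (large_full N P HP)].
          intros x _ i Hi; lia.
        (* A cell in [P] is split by the next column and one half stays in [P]; [b] tells which. *)
        - assert (G : forall b : Prop, P (fun x => cell N (bit d) L x /\ (b <-> N (pr L x))) ->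
             exists d', P (cell N (bit d') (S L))).
          { intros b Hb. exists (res (fun x => x < L /\ bit d x \/ x = L /\ b) (S L)).
            eapply (large_up N P HP); [|exact Hb]. intros x [H1 H2] i Hi.
            rewrite res_bit by auto. destruct (Nat.eq_dec i L) as [->|Hn].
            - rewrite <- H2. intuition lia.
            - assert (Hc : bit d i <-> N (pr i x)) by (apply H1; lia). rewrite <- Hc. intuition lia. }
          destruct (large_part N P HP _ (fun x => N (pr L x)) Hd) as [H|H].
          + apply (G True). eapply (large_up N P HP); [|exact H]. cbn. tauto.
          + apply (G False). eapply (large_up N P HP); [|exact H]. cbn. tauto. }
      exists d. intros l Hl Hc. apply Hc.
      eapply (large_up N P HP); [|exact Hd]. intros x Hx i Hi.
      rewrite res_bit by auto. apply Hx; lia.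
    + exists Z. intros l [e He]. rewrite p1_pr, p2_pr in He.
      apply (HZ l). intro Hc. apply He. apply ER; auto.
  - exists I; split; auto. intro L. apply ER. intro e.
    apply NNPP; intro He. apply (HC L). exists e. rewrite p1_pr, p2_pr.
    rewrite (cell_ext N (bit (res I L)) I); auto. intros; apply res_bit; auto.
Qed.

Variable I : nat -> Prop.
Hypothesis HU : ultra N P I.
Hypothesis HI : inM N' I.

Lemma ultra_mem i : I i -> P (col N i).
Proof.
  intro Hi. eapply (large_up N P HP); [|apply (HU (S i))].
  intros x Hx. apply Hx; auto.
Qed.

(** At a point of a long enough cell, finitely many columns take the truth values given by [I]; the
    filter properties below are read off there. *)
Lemma ultra_point L : exists x, cell N I L x.
Proof. destruct (large_inf N P HP _ (HU L) 0) as [x [_ Hx]]; eauto. Qed.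

Lemma ultra_cover a b c : I a -> (forall x, col N a x -> col N b x \/ col N c x) -> I b \/ I c.
Proof.
  intros Ha H. destruct (ultra_point (S (a + b + c))) as [x Hx].
  destruct (H x) as [Hb|Hc].
  - apply Hx; auto; lia.
  - left. apply (Hx b); auto; lia.
  - right. apply (Hx c); auto; lia.
Qed.

Lemma ultra_meet a b : I a -> I b -> exists x, col N a x /\ col N b x.
Proof.
  intros Ha Hb. destruct (ultra_point (S (a + b))) as [x Hx]. exists x.
  split; apply Hx; auto; lia.
Qed.

Lemma ultra_nonempty : exists a, I a.
Proof.
  destruct (inM_full O N HN) as [a Ha]. exists a.
  destruct (ultra_point (S a)) as [x Hx]. apply (Hx a); auto.
  change (col N a x). rewrite <- Ha; exact Logic.I.
Qed.

Definition next (Y : nat -> Prop) : Prop :=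
  forall Q, re N Q -> (forall i, I i -> up Q (col N i)) -> up Q Y.

(** The open classes whose intersection is [P] contain the ultrafilter, so they are among those that
    [next] quantifies over. *)
Lemma next_sub Y : next Y -> P Y.
Proof.
  intro HY. destruct (large_def N P HP) as [R [HR ER]]. apply ER. intro e.
  apply HY.
  - destruct HR as [j HR]; exists j. cs.
  - intros i Hi. apply ER, ultra_mem; auto.
Qed.

Lemma sigma1_halts_below f g h : comput N f -> comput N g -> comput N h ->
  sigma1 N (fun w => halts (below N (f w)) (g w) (h w)).
Proof.
  intros Hf Hg Hh.
  apply (sigma1_ext N (fun w => exists l, halts_at (g w) (h w) l (res (below N (f w)) l))).
  - intro w; symmetry; apply halts_at_spec.
  - unfold below. pose proof (decid_self N). cs.
Qed.

Lemma next_large : large N' next.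
Proof.
  split.
  - intros Y Z H HY Q HQ HQI. eapply up_mono; [exact H|]. apply HY; auto.
  - intros Y HY. apply (large_inf N P HP), next_sub; auto.
  - intros Q HQ HQI. destruct ultra_nonempty as [a Ha].
    eapply up_mono; [|apply (HQI a Ha)]. auto.
  - intros Y Z HY. apply NNPP; intro H. apply not_or_and in H as [H0 H1].
    apply not_all_ex_not in H0 as [Q0 H0]. apply imply_to_and in H0 as [R0 H0].
    apply imply_to_and in H0 as [K0 H0].
    apply not_all_ex_not in H1 as [Q1 H1]. apply imply_to_and in H1 as [R1 H1].
    apply imply_to_and in H1 as [K1 H1].
    (* If a member of the ultrafilter were outside this class, a splitting in the ideal would avoid
       [Q0] and [Q1], yet one of its parts is in the ultrafilter and hence in its class. So [next]
       puts [Y] in the class, against the splitting by [Z]. *)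
    assert (Hup : up (part Q0 Q1) Y).
    { apply HY.
      - destruct (re_common N Q0 Q1 _ R0 R1 (inM_full O N HN)) as [j [S0 [S1 _]]].
        exists j. unfold part, up, fsub. cs.
      - intros i Hi. apply NNPP; intro Hn.
        destruct (part_member O N Q0 Q1 (col N i) HN) as [W [HW [G0 G1]]]; auto.
        { exists i; auto. }
        destruct (inM_and O N (col N i) W HN) as [b Hb]; auto; [exists i; auto|].
        destruct (inM_diff O N (col N i) W HN) as [c Hc]; auto; [exists i; auto|].
        rewrite Hb in G0. rewrite Hc in G1.
        destruct (ultra_cover i b c Hi); auto.
        intros x Hx. rewrite <- Hb, <- Hc. destruct (classic (W x)); auto. }
    rewrite part_spec in Hup. destruct (Hup Z); auto.
  (* The pairs [pr e j] list all open classes c.e. in the ideal. The first alternative replaces a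
     class that misses a member of the ultrafilter by the class of all sets; it is c.e. in [N'],
     which contains [I] and [jump O]. *)
  - exists (fun w => (exists i, I i /\
       ~ up (halts (below N (p2 (p1 w))) (p1 (p1 w))) (col N i)) \/
       halts (below N (p2 (p1 w))) (p1 (p1 w)) (p2 w)).
    split.
    + destruct HI as [c Hc]. exists (S c).
      assert (HI' : decid (below N' (S c)) I) by (rewrite Hc; apply decid_col; auto).
      assert (HJ : decid (below N' (S c)) (jump O)).
      { eapply decid_oracle_trans; [apply (decid_below_le N' 1); lia|apply scott_base; auto]. }
      apply sigma1_or.
      * apply sigma1_ex, sigma1_and; [cs|]. apply sigma1_dec, decid_not.
        apply (decid_oracle_trans _ (jump O)); auto. apply Hlow.
        apply sigma1_up; [apply sigma1_halts_below; cs|].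
        unfold col. pose proof (decid_self N). cs.
      * apply sigma1_dec, (decid_oracle_trans _ (jump O)); auto. apply Hlow.
        apply sigma1_halts_below; cs.
    + intro Y. split.
      * intros HY q.
        destruct (classic (exists i, I i /\ ~ up (halts (below N (p2 q)) (p1 q)) (col N i)))
          as [Hi|Hi].
        -- exists 0. split; [intros y Hy; lia|]. left. rewrite p1_pr. auto.
        -- destruct (HY (halts (below N (p2 q)) (p1 q))) as [D [HD HQ]].
           ++ exists (p2 q). apply (sigma1_halts_oracle _ _ (fun _ => p1 q) (fun c => c)); cs.
           ++ intros i Hii. apply NNPP; intro Hn. apply Hi; eauto.
           ++ exists D; split; auto. right. rewrite p1_pr, p2_pr. auto.
      * intros H Q [j [e He]%sigma1_index] HQ.
        assert (E : Q = halts (below N j) e) by (apply set_ext; auto). subst Q.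
        destruct (H (pr e j)) as [D [HD [[i [Hi Hn]]|Hh]]].
        -- destruct Hn. repeat rewrite ?p1_pr, ?p2_pr. auto.
        -- exists D; split; auto. revert Hh. repeat rewrite ?p1_pr, ?p2_pr. auto.
Qed.

(** The open class of sets meeting column [i] contains the ultrafilter, hence all of [next]. So the
    part of [Y] outside the column is not in [next], and partition regularity yields the other
    part. *)
Lemma next_cofinal Y i : next Y -> I i -> next (fun x => Y x /\ col N i x).
Proof.
  intros HY Hi. destruct (large_part N' next next_large _ (col N i) HY) as [H|H]; auto.
  exfalso. destruct (H (fun D => exists x, bit D x /\ col N i x)) as [D [HD [x [Hb Hx]]]].
  - exists (S i). pose proof (decid_col N i (S i) (Nat.lt_succ_diag_r i)). cs.
  - intros a Ha. destruct (ultra_meet a i Ha Hi) as [x [H1 H2]].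
    exists (res (fun y => y = x) (S x)). split.
    + intros y _ [_ ->]%res_spec; auto.
    + exists x; split; auto. apply res_bit; auto.
  - destruct (HD x (bit_lt _ _ Hb) Hb); auto.
Qed.

Lemma inM_step Y : inM N Y -> inM N' Y.
Proof.
  intros [c ->]. apply (scott_closed (jump O) N' 1); auto.
  apply (decid_oracle_trans _ (jump O)); [apply scott_base; auto|].
  apply Hlow, sigma1_dec, decid_col_self.
Qed.
End Step.

(** * Iterated jumps in normal form *)

(** The prefix [exists x, ~] at each level expresses the alternation of quantifiers with a single
    clause. *)
Fixpoint Sat (m : nat) (W : nat -> Prop) (z : nat) (G : nat -> Prop) : Prop :=
  match m with
  | 0 => exists l, W (pr z (pr l (res G l)))
  | S m => exists x, ~ Sat m W (pr z x) G
  end.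

(* [Form m] are the families of Sigma_(m+1) properties of [G]. *)
Definition Form (m : nat) (F : (nat -> Prop) -> nat -> Prop) : Prop :=
  exists W, (forall Y, decid Y W) /\ forall G z, F G z <-> Sat m W z G.

Lemma Form_ext m F F' : (forall G z, F G z <-> F' G z) -> Form m F -> Form m F'.
Proof. intros E [W [H1 H2]]; exists W; split; auto. intros; rewrite <- E; auto. Qed.

Lemma Form_0_intro F K :
  (forall Y, decid Y (fun w => K (p1 w) (p1 (p2 w)) (p2 (p2 w)))) ->
  (forall G z, F G z <-> exists l, K z l (res G l)) -> Form 0 F.
Proof.
  intros HK E. exists (fun w => K (p1 w) (p1 (p2 w)) (p2 (p2 w))). split; auto.
  intros G z. rewrite E. cbn [Sat].
  split; intros [l Hl]; exists l; revert Hl; repeat rewrite ?p1_pr, ?p2_pr; auto.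
Qed.

Lemma Form_0_elim F : Form 0 F -> exists K : nat -> nat -> nat -> Prop,
  (forall Y f g h, comput Y f -> comput Y g -> comput Y h ->
     decid Y (fun c => K (f c) (g c) (h c))) /\
  (forall G z, F G z <-> exists l, K z l (res G l)).
Proof.
  intros [W [HW E]]. exists (fun z l d => W (pr z (pr l d))). split; auto.
  intros Y f g h Hf Hg Hh. specialize (HW Y). cs.
Qed.

Lemma Form_S_intro m F H : Form m (fun G w => H G (p1 w) (p2 w)) ->
  (forall G z, F G z <-> exists x, ~ H G z x) -> Form (S m) F.
Proof.
  intros [W [HW E]] EF. exists W; split; auto. intros G z. rewrite EF. cbn [Sat].
  split; intros [x Hx]; exists x; intro Hs; apply Hx.
  - apply E in Hs. rewrite p1_pr, p2_pr in Hs; auto.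
  - apply E. rewrite p1_pr, p2_pr; auto.
Qed.

Lemma Form_S_elim m F : Form (S m) F -> exists H,
  Form m (fun G w => H G (p1 w) (p2 w)) /\ forall G z, F G z <-> exists x, ~ H G z x.
Proof.
  intros [W [HW E]]. exists (fun G z x => Sat m W (pr z x) G). split; [|apply E].
  exists W; split; auto. intros G z; rewrite pr_eta; tauto.
Qed.

Lemma Form_subst m : forall F f, Form m F -> (forall Y, comput Y f) ->
  Form m (fun G c => F G (f c)).
Proof.
  induction m as [|m IH]; intros F f HF Hf.
  - apply Form_0_elim in HF as [K [HK E]].
    apply (Form_0_intro _ (fun z l d => K (f z) l d)); auto.
    intro Y. specialize (Hf Y). apply HK; cs.
  - apply Form_S_elim in HF as [H [HH E]].
    apply (Form_S_intro m _ (fun G z x => H G (f z) x)); auto.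
    apply (Form_ext m (fun G w => H G (p1 (pr (f (p1 w)) (p2 w))) (p2 (pr (f (p1 w)) (p2 w))))).
    + intros; rewrite p1_pr, p2_pr; tauto.
    + apply (IH (fun G w => H G (p1 w) (p2 w)) (fun w => pr (f (p1 w)) (p2 w))); auto.
      intro Y; specialize (Hf Y); cs.
Qed.

Lemma Form_subst2 m F f g : Form m (fun G w => F G (p1 w) (p2 w)) ->
  (forall Y, comput Y f) -> (forall Y, comput Y g) -> Form m (fun G c => F G (f c) (g c)).
Proof.
  intros HF Hf Hg.
  apply (Form_ext m (fun G c => F G (p1 (pr (f c) (g c))) (p2 (pr (f c) (g c))))).
  - intros; rewrite p1_pr, p2_pr; tauto.
  - apply (Form_subst m (fun G w => F G (p1 w) (p2 w)) (fun c => pr (f c) (g c))); auto.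
    intro Y; specialize (Hf Y); specialize (Hg Y); cs.
Qed.

Lemma Form_dec m : forall R, (forall Y, decid Y R) -> Form m (fun _ c => R c).
Proof.
  induction m as [|m IH]; intros R HR.
  - apply (Form_0_intro _ (fun z _ _ => R z)).
    + intro Y; specialize (HR Y); cs.
    + intros G z; split; [intro; exists 0; auto|intros [_ H]; auto].
  - apply (Form_S_intro m _ (fun _ z _ => ~ R z)).
    + apply (IH (fun w => ~ R (p1 w))). intro Y; specialize (HR Y); cs.
    + intros G z; split; [intro H; exists 0; auto|intros [_ H]; apply NNPP; auto].
Qed.

(** Proved together because the negation in the successor step exchanges conjunction and
    disjunction. *)
Lemma Form_and_or m : forall F F', Form m F -> Form m F' ->
  Form m (fun G c => F G c /\ F' G c) /\ Form m (fun G c => F G c \/ F' G c).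
Proof.
  induction m as [|m IH]; intros F F' HF HF'.
  - apply Form_0_elim in HF as [K [HK E]]. apply Form_0_elim in HF' as [K' [HK' E']]. split.
    + apply (Form_0_intro _ (fun z l d => (exists a, a < S l /\ K z a (res (bit d) a)) /\
                                          (exists a, a < S l /\ K' z a (res (bit d) a)))).
      * intro Y. cs; [apply HK|apply HK']; cs.
      * intros G z. rewrite E, E'. split.
        -- intros [[a Ha] [b Hb]]. exists (a + b).
           split; [exists a|exists b]; rewrite res_res by lia; split; auto; lia.
        -- intros [l [[a [Hl Ha]] [b [Hl' Hb]]]].
           rewrite res_res in Ha, Hb by lia; eauto.
    + apply (Form_0_intro _ (fun z l d => K z l d \/ K' z l d)).
      * intro Y. apply decid_or; [apply HK|apply HK']; cs.
      * intros G z. rewrite E, E'. split.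
        -- intros [[a Ha]|[a Ha]]; eauto.
        -- intros [a [Ha|Ha]]; eauto.
  - apply Form_S_elim in HF as [H [HH E]]. apply Form_S_elim in HF' as [H' [HH' E']]. split.
    + apply (Form_S_intro m _ (fun G z x => H G z (p1 x) \/ H' G z (p2 x))).
      * apply IH; apply Form_subst2; auto; intro Y; cs.
      * intros G z. rewrite E, E'. split.
        -- intros [[x Hx] [y Hy]]. exists (pr x y). rewrite p1_pr, p2_pr. tauto.
        -- intros [x Hx]. split; eauto.
    + apply (Form_S_intro m _ (fun G z x => H G z x /\ H' G z x)).
      * apply IH; auto.
      * intros G z. rewrite E, E'. split.
        -- intros [[x Hx]|[x Hx]]; exists x; tauto.
        -- intros [x Hx]. apply not_and_or in Hx as [Hx|Hx]; eauto.
Qed.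

Lemma Form_and m F F' : Form m F -> Form m F' -> Form m (fun G c => F G c /\ F' G c).
Proof. intros; apply Form_and_or; auto. Qed.
Lemma Form_or m F F' : Form m F -> Form m F' -> Form m (fun G c => F G c \/ F' G c).
Proof. intros; apply Form_and_or; auto. Qed.

Lemma Form_ex m F : Form m (fun G w => F G (p1 w) (p2 w)) ->
  Form m (fun G c => exists y, F G c y).
Proof.
  destruct m as [|m]; intro HF.
  - apply Form_0_elim in HF as [K [HK E]].
    apply (Form_0_intro _ (fun z l d => exists y, y < S l /\ exists a, a < S l /\
      K (pr z y) a (res (bit d) a))).
    + intro Y. cs. apply HK; cs.
    + intros G z. assert (E' : forall y, F G z y <-> exists l, K (pr z y) l (res G l)).
      { intro y. rewrite <- E, p1_pr, p2_pr. tauto. }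
      split.
      * intros [y [a Ha]%E']. exists (y + a). exists y; split; [lia|].
        exists a; split; [lia|]. rewrite res_res by lia. auto.
      * intros [l [y [Hy [a [Ha H]]]]]. exists y. apply E'.
        rewrite res_res in H by lia; eauto.
  - apply Form_S_elim in HF as [H [HH E]].
    apply (Form_S_intro m _ (fun G z x => H G (pr z (p1 x)) (p2 x))).
    + apply (Form_subst2 m H (fun w => pr (p1 w) (p1 (p2 w))) (fun w => p2 (p2 w))); auto;
        intro Y; cs.
    + intros G z. assert (E' : forall y, F G z y <-> exists x, ~ H G (pr z y) x).
      { intro y. rewrite <- E, p1_pr, p2_pr. tauto. }
      split.
      * intros [y [x Hx]%E']. exists (pr y x). rewrite p1_pr, p2_pr; auto.
      * intros [x Hx]. exists (p1 x). apply E'; eauto.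
Qed.

Lemma Form_ball m : forall F b, (forall Y, comput Y b) ->
  Form m (fun G w => F G (p1 w) (p2 w)) -> Form m (fun G c => forall y, y < b c -> F G c y).
Proof.
  induction m as [|m IH]; intros F b Hb HF.
  - apply Form_0_elim in HF as [K [HK E]].
    apply (Form_0_intro _ (fun z l d => forall y, y < b z -> exists a, a < S l /\
      K (pr z y) a (res (bit d) a))).
    + intro Y. specialize (Hb Y). cs. apply HK; cs.
    + intros G z. assert (E' : forall y, F G z y <-> exists l, K (pr z y) l (res G l)).
      { intro y. rewrite <- E, p1_pr, p2_pr. tauto. }
      split.
      * intro H. destruct (collection (b z) (fun y l => K (pr z y) l (res G l))) as [t Ht].
        { intros y Hy; apply E'; auto. }
        exists t. intros y Hy. destruct (Ht y Hy) as [a [Ha Hk]]. exists a; split; [lia|].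
        rewrite res_res by lia; auto.
      * intros [l H] y Hy. apply E'. destruct (H y Hy) as [a [Ha Hk]].
        rewrite res_res in Hk by lia; eauto.
  - apply Form_S_elim in HF as [H [HH E]].
    (* By collection one [t] bounds the witnesses for all [y < b z]; the matrix is then one level
       lower and its bounded quantifier falls under the induction hypothesis. *)
    apply (Form_S_intro m _ (fun G z t => exists y, y < b z /\ forall x, x < t -> H G (pr z y) x)).
    + apply Form_ex, Form_and.
      * apply Form_dec. intro Y; specialize (Hb Y); cs.
      * apply (IH (fun G w x => H G (pr (p1 (p1 w)) (p2 w)) x) (fun w => p2 (p1 w))).
        { intro Y; cs. }
        apply (Form_subst2 m H (fun w => pr (p1 (p1 (p1 w))) (p2 (p1 w))) p2); auto;
          intro Y; cs.
    + intros G z. assert (E' : forall y, F G z y <-> exists x, ~ H G (pr z y) x).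
      { intro y. rewrite <- E, p1_pr, p2_pr. tauto. }
      split.
      * intro Hz. destruct (collection (b z) (fun y x => ~ H G (pr z y) x)) as [t Ht].
        { intros y Hy; apply E'; auto. }
        exists t. intros [y [Hy Hx]]. destruct (Ht y Hy) as [x [Hl Hn]]; auto.
      * intros [t Ht] y Hy. apply E'. apply NNPP; intro Hn. apply Ht. exists y; split; auto.
        intros x _. apply NNPP; intro Hx. apply Hn; eauto.
Qed.

Lemma Form_not m F : Form m F -> Form (S m) (fun G c => ~ F G c).
Proof.
  intro HF. apply (Form_S_intro m _ (fun G z _ => F G z)).
  - apply Form_subst; auto. intro Y; cs.
  - intros G z; split; [intro; exists 0; auto|intros [_ H]; auto].
Qed.

Lemma Form_lift m : forall F, Form m F -> Form (S m) F.
Proof.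
  induction m as [|m IH]; intros F HF.
  - apply Form_0_elim in HF as [K [HK E]].
    apply (Form_S_intro 0 _ (fun G z l => ~ K z l (res G l))).
    (* The outer variable already names the length, and [l = p2 w] pins the inner search to it. *)
    + apply (Form_0_intro _ (fun w l d => l = p2 w /\ ~ K (p1 w) l d)).
      * intro Y. apply decid_and; [cs|]. apply decid_not, HK; cs.
      * intros G w; split; [intro; exists (p2 w); auto|intros [l [-> H]]; auto].
    + intros G z. rewrite E.
      split; intros [l Hl]; exists l; [auto|apply NNPP; auto].
  - apply Form_S_elim in HF as [H [HH E]]. apply (Form_S_intro (S m) _ H); auto.
Qed.

Lemma Form_halts n : Form n (fun G c => halts (njump n G) (p1 c) (p2 c)).
Proof.
  induction n as [|n IH].
  - apply (Form_0_intro _ (fun c l d => halts_at (p1 c) (p2 c) l d)).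
    + intro Y; cs.
    + intros G z. apply halts_at_spec.
  - assert (HJ : Form n (fun G y => njump (S n) G y)).
    { apply (Form_ext n (fun G y => halts (njump n G) y y)); [intros; reflexivity|].
      apply (Form_subst2 n (fun G => halts (njump n G)) (fun y => y) (fun y => y)); auto;
        intro Y; cs. }
    (* A guessed mask [d] replaces the oracle. Its correctness below [l] uses the jump positively
       and negatively, and both are available at level [S n]. *)
    apply (Form_ext (S n) (fun G c => exists l d,
      (halts_at (p1 c) (p2 c) l d /\ d < 2 ^ l) /\
      forall y, y < l -> (bit d y /\ njump (S n) G y) \/ (~ bit d y /\ ~ njump (S n) G y))).
    + intros G c. rewrite halts_at_spec. split.
      * intros [l [d [[Hh Hd] H]]]. exists l.
        replace (res (njump (S n) G) l) with d; auto.
        rewrite <- (res_of_bit d l Hd). apply res_ext. intros x Hx.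
        destruct (H x Hx); tauto.
      * intros [l Hl]. exists l, (res (njump (S n) G) l). split; [split; auto; apply res_lt|].
        intros y Hy. rewrite res_bit by auto. tauto.
    + apply Form_ex, Form_ex, Form_and.
      * apply Form_dec. intro Y; cs.
      * apply (Form_ball (S n) (fun G w y => (bit (p2 w) y /\ njump (S n) G y) \/
           (~ bit (p2 w) y /\ ~ njump (S n) G y)) (fun w => p2 (p1 w))).
        { intro Y; cs. }
        apply Form_or; apply Form_and.
        -- apply Form_dec; intro Y; cs.
        -- apply (Form_subst (S n) (fun G y => njump (S n) G y) p2); [apply Form_lift; auto|].
           intro Y; cs.
        -- apply Form_dec; intro Y; cs.
        -- apply (Form_subst (S n) (fun G y => ~ njump (S n) G y) p2); [|intro Y; cs].
           apply (Form_not n (fun G y => njump (S n) G y)); auto.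
Qed.

(** * Forcing *)

(* A string [s] is the pair of its length [p1 s] and the mask [p2 s] of its elements;
   [ext Y s t] says that [t] extends [s] by elements of [Y]. *)
Definition ext (Y : nat -> Prop) (s t : nat) : Prop :=
  p1 s <= p1 t /\ forall x, x < p1 t ->
    (x < p1 s -> (bit (p2 t) x <-> bit (p2 s) x)) /\ (p1 s <= x -> bit (p2 t) x -> Y x).

Lemma ext_refl Y s : ext Y s s.
Proof. split; auto. intros x Hx; split; [tauto|lia]. Qed.

Lemma ext_trans (Y Z : nat -> Prop) s t u : (forall x, Z x -> Y x) ->
  ext Y s t -> ext Z t u -> ext Y s u.
Proof.
  intros H [H1 H2] [H3 H4]. split; [lia|]. intros x Hx. split.
  - intro Hs. rewrite (proj1 (H4 x Hx)) by lia. apply H2; lia.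
  - intros Hs Hb. destruct (le_lt_dec (p1 t) x) as [Hl|Hl].
    + apply H, H4; auto.
    + apply H2; auto. apply H4; auto.
Qed.

Lemma ext_mono (Y Z : nat -> Prop) s t : (forall x, Y x -> Z x) -> ext Y s t -> ext Z s t.
Proof. intros H He. apply (ext_trans Z Y s s t); auto. apply ext_refl. Qed.

Definition reach (Q : nat -> Prop) (s : nat) (Y : nat -> Prop) : Prop :=
  exists t, ext Y s t /\ Q t.

Lemma reach_mono Q s (Y Z : nat -> Prop) : (forall x, Y x -> Z x) ->
  reach Q s Y -> reach Q s Z.
Proof. intros H [t [Ht Hq]]; exists t; split; auto. apply (ext_mono Y); auto. Qed.

(** An extension draws only finitely many elements from [Y], so the class is open and upward closed
    and [next] applies to it. *)
Lemma reach_up Q s Y : reach Q s Y <-> up (fun D => reach Q s (bit D)) Y.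
Proof.
  split.
  - intros [t [[H1 H2] Hq]].
    exists (res (fun x => p1 s <= x /\ bit (p2 t) x) (p1 t)). split.
    + intros y _ [Hy [H3 H4]]%res_spec. apply H2; auto.
    + exists t; split; auto. split; auto. intros x Hx. split; [apply H2; auto|].
      intros H3 H4. apply res_bit; auto.
  - intros [D [HD H]]. eapply reach_mono; [|exact H]. intros x Hb; apply HD; auto.
    apply bit_lt; auto.
Qed.

Lemma sigma1_reach Y Q X f : sigma1 Y (fun w => Q (p1 w) (p2 w)) ->
  decid Y (fun w => X (p1 w) (p2 w)) -> comput Y f ->
  sigma1 Y (fun c => reach (Q c) (f c) (X c)).
Proof. intros. unfold reach, ext. cs. Qed.

(** At level 0 the string shows a witness within its own length. At a successor level, some member
    of the ultrafilter serves as a reservoir that, together with [t], forces the negation of the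
    formula [pr z x]. *)
Fixpoint Opn (N I : nat -> nat -> Prop) (W : nat -> Prop) (m z t : nat) : Prop :=
  match m with
  | 0 => exists l, l < S (p1 t) /\ W (pr z (pr l (res (bit (p2 t)) l)))
  | S m => exists x i, I m i /\ ~ reach (Opn N I W m (pr z x)) t (col (N m) i)
  end.

Section Forcing.
Variables (n : nat) (B : nat -> Prop) (N I : nat -> nat -> Prop)
  (P : nat -> (nat -> Prop) -> Prop) (W : nat -> Prop).
Hypothesis Hscott : forall k, k <= n -> scott (njump k emptyset) (N k).
Hypothesis Hlow : forall k, k < n -> forall Q, sigma1 (N k) Q -> decid (njump (S k) emptyset) Q.
Hypothesis Hlarge : forall k, k <= n -> large (N k) (P k).
Hypothesis Hultra : forall k, k < n -> ultra (N k) (P k) (I k).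
Hypothesis HI : forall k, k < n -> inM (N (S k)) (I k).
Hypothesis Hnext : forall k, k < n -> P (S k) = next (N k) (I k).
Hypothesis HB : ~ sigma1 (N n) B.
Hypothesis HW : forall Y, decid Y W.

Notation opn := (Opn N I W).

(** [reach] is c.e. in [N m], so by lowness its failure is decidable in the next jump; this jump and
    [I m] belong to the ideal of [N (S m)]. *)
Lemma opn_re m : m <= n -> re (N m) (fun w => opn m (p1 w) (p2 w)).
Proof.
  induction m as [|m IH]; intro Hm.
  - exists 0. cbn [Opn]. specialize (HW (below (N 0) 0)). cs.
  - assert (IH' := re_sigma1 _ _ (IH ltac:(lia))).
    destruct (HI m Hm) as [c Hc]. exists (S c).
    assert (HJ : decid (below (N (S m)) (S c)) (njump (S m) emptyset)).
    { eapply decid_oracle_trans; [apply (decid_below_le _ 1); lia|apply scott_base; auto]. }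
    assert (HI' : decid (below (N (S m)) (S c)) (I m)) by (rewrite Hc; apply decid_col; auto).
    cbn [Opn]. apply sigma1_ex, sigma1_ex, sigma1_and; [cs|].
    apply sigma1_dec, decid_not. apply (decid_oracle_trans _ (njump (S m) emptyset)); auto.
    apply Hlow; auto.
    apply (sigma1_reach (N m)
      (fun c => opn m (pr (p1 (p1 (p1 c))) (p2 (p1 c)))) (fun c => col (N m) (p2 c))
      (fun c => p2 (p1 (p1 c)))).
    + apply (sigma1_app2 (N m) (opn m) (fun w => pr (p1 (p1 (p1 (p1 w)))) (p2 (p1 (p1 w)))) p2);
        auto; cs.
    + unfold col. pose proof (decid_self (N m)). cs.
    + cs.
Qed.

Lemma opn_reach_re m z s : m <= n -> re (N m) (fun D => reach (opn m z) s (bit D)).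
Proof.
  intro Hm. destruct (opn_re m Hm) as [j Hj]. exists j.
  apply (sigma1_reach _ (fun _ => opn m z) bit (fun _ => s)); [|cs|cs].
  apply (sigma1_app2 _ (opn m) (fun _ => z) p2); auto; cs.
Qed.

Lemma P_antitone k Y : k <= n -> P n Y -> P k Y.
Proof.
  intros Hk HY.
  assert (H : forall j, k <= j -> j <= n -> P j Y -> P k Y).
  { intros j Hj. induction Hj as [|j Hj IH]; auto. intros Hn Hp. apply IH; [lia|].
    rewrite Hnext in Hp by lia.
    eapply next_sub; [apply Hlarge; lia|apply Hultra; lia|exact Hp]. }
  apply (H n); auto.
Qed.

Lemma inM_lift k Y : k <= n -> inM (N k) Y -> inM (N n) Y.
Proof.
  intros Hk HY.
  assert (H : forall j, k <= j -> j <= n -> inM (N j) Y).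
  { intros j Hj. induction Hj as [|j Hj IH]; auto. intro Hn.
    apply (inM_step (njump j emptyset) (N j)); auto.
    - apply Hlow; lia.
    - apply (Hscott (S j)); lia.
    - apply IH; lia. }
  apply (H n); auto.
Qed.

(** * Conditions and the forcing relations *)

Definition cond (A X : nat -> Prop) : Prop := inM (N n) X /\ P n (fun x => X x /\ A x).

Definition fneg (m z s : nat) (X : nat -> Prop) : Prop := ~ reach (opn m z) s X.
Definition fpos (m z s : nat) (X : nat -> Prop) : Prop :=
  match m with
  | 0 => opn 0 z s
  | S m => exists x, fneg m (pr z x) s X
  end.

Definition stronger (A : nat -> Prop) (s' : nat) (X' : nat -> Prop) (s : nat) (X : nat -> Prop) : Prop :=
  ext (fun x => X x /\ A x) s s' /\ forall x, X' x -> X x.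

Lemma stronger_refl A s X : stronger A s X s X.
Proof. split; auto. apply ext_refl. Qed.

Lemma stronger_trans A s1 X1 s2 X2 s3 X3 : stronger A s1 X1 s2 X2 -> stronger A s2 X2 s3 X3 -> stronger A s1 X1 s3 X3.
Proof.
  intros [H1 H2] [H3 H4]. split; auto.
  eapply ext_trans; [|exact H3|exact H1]. cbn. intros x [? ?]; auto.
Qed.

Lemma fneg_stronger A m z s X s' X' : stronger A s' X' s X -> fneg m z s X -> fneg m z s' X'.
Proof.
  intros [H1 H2] H [t [Ht Ho]]. apply H. exists t; split; auto.
  eapply ext_trans; [exact H2| |exact Ht]. eapply ext_mono; [|exact H1]. cbn; tauto.
Qed.

(** If the part of the reservoir in [A] but outside the column were in [P n], it would be in
    [P (S m)] and meet the column by [next_cofinal]. *)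
Lemma shrink A X m i : m < n -> I m i -> cond A X -> cond A (fun x => X x /\ col (N m) i x).
Proof.
  intros Hm Hi [H1 H2]. assert (Hl := Hlarge n (le_n n)). split.
  - apply (inM_and (njump n emptyset)); auto. apply (inM_lift m); [lia|]. exists i; auto.
  - destruct (large_part _ _ Hl _ (col (N m) i) H2) as [H|H].
    + eapply (large_up _ _ Hl); [|exact H]. cbn. tauto.
    + exfalso. apply (P_antitone (S m)) in H; auto. rewrite Hnext in H by auto.
      apply (fun H => next_cofinal (njump m emptyset) (N m) (N (S m)) (P m) (Hscott m ltac:(lia))
        (Hlow m Hm) (Hscott (S m) Hm) (Hlarge m ltac:(lia)) (I m) (Hultra m Hm) (HI m Hm)
        _ i H Hi) in H.
      rewrite <- Hnext in H by auto.
      destruct (large_inf _ _ (Hlarge (S m) Hm) _ H 0) as [x [_ Hx]]. tauto.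
Qed.

Lemma dense_pos A m z s X : m <= n -> cond A X -> reach (opn m z) s (fun x => X x /\ A x) ->
  exists s' X', cond A X' /\ stronger A s' X' s X /\ fpos m z s' X'.
Proof.
  intros Hm HX [t [Ht Ho]]. destruct m as [|m].
  - exists t, X. split; auto. split; auto. split; auto.
  - destruct Ho as [x [i [Hi Hr]]]. exists t, (fun x => X x /\ col (N m) i x).
    split; [apply shrink; auto|split].
    + split; [auto|tauto].
    + exists x. intro Hr'. apply Hr. eapply reach_mono; [|exact Hr']. cbn; tauto.
Qed.

Lemma large_reach m z s Y : m < n -> P (S m) Y ->
  (forall i, I m i -> reach (opn m z) s (col (N m) i)) -> reach (opn m z) s Y.
Proof.
  intros Hm HY H. rewrite Hnext in HY by auto. apply reach_up, HY.
  - apply opn_reach_re; lia.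
  - intros i Hi. apply reach_up; auto.
Qed.

Lemma dense_decide A m z s X : m < n -> cond A X ->
  exists s' X', cond A X' /\ stronger A s' X' s X /\ (fpos m z s' X' \/ fneg m z s' X').
Proof.
  intros Hm HX.
  destruct (classic (forall i, I m i -> reach (opn m z) s (col (N m) i))) as [H|H].
  - destruct (dense_pos A m z s X) as [s' [X' [H1 [H2 H3]]]]; auto; [lia| |eauto 6].
    apply large_reach; auto. apply (P_antitone (S m)); auto. apply HX.
  - apply not_all_ex_not in H as [i H]. apply imply_to_and in H as [Hi H].
    exists s, (fun x => X x /\ col (N m) i x). split; [apply shrink; auto|]. split.
    + split; [apply ext_refl|tauto].
    + right. intro Hr. apply H. eapply reach_mono; [|exact Hr]. cbn; tauto.
Qed.

Lemma dense_grow A b s X : cond A X -> exists s', stronger A s' X s X /\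
  exists x, b <= x /\ x < p1 s' /\ bit (p2 s') x.
Proof.
  intros [_ HX]. destruct (large_inf _ _ (Hlarge n (le_n n)) _ HX (b + p1 s)) as [x [Hx [H1 H2]]].
  (* [s] is padded with zeros up to [x], and [x] is added. *)
  exists (pr (S x) (res (fun y => y < p1 s /\ bit (p2 s) y \/ y = x) (S x))).
  assert (Hb : bit (res (fun y => y < p1 s /\ bit (p2 s) y \/ y = x) (S x)) x).
  { apply res_bit; auto. }
  split; [split; [|auto]; split; rewrite ?p1_pr, ?p2_pr; [lia|]|].
  - intros y Hy. split.
    + intro Hl. rewrite res_bit by auto. intuition lia.
    + intros Hl [_ [Hc| ->]]%res_spec; [lia|auto].
  - exists x. rewrite p1_pr, p2_pr. repeat split; auto; lia.
Qed.

Definition meets (e s : nat) (X : nat -> Prop) : Prop :=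
  (exists x, ~ B x /\ fpos n (pr e x) s X) \/ (exists x, B x /\ fneg n (pr e x) s X).

Definition stuck (A : nat -> Prop) (e s : nat) (X : nat -> Prop) : Prop :=
  cond A X /\ forall s' X', cond A X' -> stronger A s' X' s X -> ~ meets e s' X'.

(** * Truth of forced formulas in the generic set *)

Section Generic.
Variables (A : nat -> Prop) (sg : nat -> nat) (Xs : nat -> nat -> Prop).
Hypothesis Hcond : forall k, cond A (Xs k).
Hypothesis Hle : forall k, stronger A (sg (S k)) (Xs (S k)) (sg k) (Xs k).
Hypothesis Hdecide : forall m z, m < n -> exists k, fpos m z (sg k) (Xs k) \/ fneg m z (sg k) (Xs k).
Hypothesis Hgrow : forall b, exists k x, b <= x /\ x < p1 (sg k) /\ bit (p2 (sg k)) x.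

Definition gen (x : nat) : Prop := exists k, x < p1 (sg k) /\ bit (p2 (sg k)) x.

Lemma chain j k : j <= k -> stronger A (sg k) (Xs k) (sg j) (Xs j).
Proof. induction 1; [apply stronger_refl|]. eapply stronger_trans; [apply Hle|auto]. Qed.

Lemma gen_old k x : x < p1 (sg k) -> (gen x <-> bit (p2 (sg k)) x).
Proof.
  intro Hx. split; [|intro; exists k; auto]. intros [j [Hj Hb]].
  destruct (Nat.le_ge_cases j k) as [H|H]; destruct (chain _ _ H) as [[_ He] _].
  - apply He; auto.
  - apply (He x); auto.
Qed.

Lemma gen_new k x : p1 (sg k) <= x -> gen x -> Xs k x /\ A x.
Proof.
  intros Hx [j [Hj Hb]].
  destruct (Nat.le_ge_cases j k) as [H|H]; destruct (chain _ _ H) as [[Hl He] _]; [lia|].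
  apply (He x); auto.
Qed.

Lemma gen_infinite : infinite gen.
Proof. intro b. destruct (Hgrow b) as [k [x [H1 H2]]]. exists x; split; auto. exists k; auto. Qed.

Lemma gen_truth m : m <= n -> forall z k,
  (fpos m z (sg k) (Xs k) -> Sat m W z gen) /\ (fneg m z (sg k) (Xs k) -> ~ Sat m W z gen).
Proof.
  induction m as [|m IH]; intros Hm z k; split.
  - intros [l [Hl Hw]]. exists l.
    rewrite (res_ext gen (bit (p2 (sg k)))); auto. intros x Hx. apply gen_old; lia.
  (* The initial segment of length [L] extends [sg k] within the reservoir and is long enough to
     show the witness [l]. *)
  - intros Hneg [l Hw]. apply Hneg. set (L := max l (p1 (sg k))). exists (pr L (res gen L)). split.
    + split; rewrite p1_pr; [lia|]. intros x Hx. rewrite p2_pr, res_bit by auto. split.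
      * apply gen_old.
      * intros H1 H2. apply (gen_new k x); auto.
    + exists l. rewrite p1_pr, p2_pr, res_res by lia. split; auto; lia.
  - intros [x Hx]. exists x. apply (IH ltac:(lia) (pr z x) k); auto.
  - intros Hneg [x Hx]. destruct (Hdecide m (pr z x) Hm) as [j [Hj|Hj]].
    + apply Hx. apply (IH ltac:(lia) (pr z x) j); auto.
    (* Since [sg t] is an allowed extension of [sg k], [Hneg] puts the whole ultrafilter in the
       class of [pr z x] at [sg t]. By [large_reach] the reservoir is in it too, against the
       decision at stage [j]. *)
    + set (t := max j k).
      apply (fneg_stronger A m (pr z x) _ _ (sg t) (Xs t)) in Hj; [|apply chain; lia].
      apply Hj. apply large_reach; auto.
      { apply (P_antitone (S m)); auto.
        eapply (large_up _ _ (Hlarge n (le_n n))); [|apply (Hcond t)]. cbn; tauto. }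
      intros i Hi. apply NNPP; intro Hr. apply Hneg. exists (sg t). split.
      * destruct (chain k t) as [He _]; [lia|]. eapply ext_mono; [|exact He]. cbn; tauto.
      * exists x, i. auto.
Qed.
End Generic.

Lemma generic_exists A X0 : cond A X0 ->
  (forall e s X, cond A X -> (forall x, X x -> X0 x) -> ~ stuck A e s X) ->
  exists G, infinite G /\ (forall x, G x -> A x) /\
    forall e, ~ forall x, B x <-> Sat n W (pr e x) G.
Proof.
  intros HX0 Hns.
  (* Tag 0 decides a formula of level below [n], tag 1 adds a large element, and any other tag
     separates [B] from the formulas of index [p2 k]. *)
  set (req := fun k (p : nat * (nat -> Prop)) => match p1 k with
    | 0 => p1 (p2 k) < n -> fpos (p1 (p2 k)) (p2 (p2 k)) (fst p) (snd p) \/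
                            fneg (p1 (p2 k)) (p2 (p2 k)) (fst p) (snd p)
    | 1 => exists x, p2 k <= x /\ x < p1 (fst p) /\ bit (p2 (fst p)) x
    | _ => meets (p2 k) (fst p) (snd p)
    end).
  set (ok := fun p : nat * (nat -> Prop) => cond A (snd p) /\ forall x, snd p x -> X0 x).
  assert (Hreq : forall k p, ok p -> exists q, ok q /\
     stronger A (fst q) (snd q) (fst p) (snd p) /\ req k q).
  { intros k [s X] [H1 H2]; cbn [fst snd] in *. unfold req, ok.
    destruct (p1 k) as [|[|t]].
    - destruct (classic (p1 (p2 k) < n)) as [Hl|Hl].
      + destruct (dense_decide A (p1 (p2 k)) (p2 (p2 k)) s X Hl H1) as [s' [X' [G1 [G2 G3]]]].
        exists (s', X'); cbn.
        split; [split; [auto|intros x Hx; apply H2, G2; auto]|split; auto].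
      + exists (s, X); cbn. split; auto. split; [apply stronger_refl|tauto].
    - destruct (dense_grow A (p2 k) s X H1) as [s' [G1 G2]]. exists (s', X); cbn; auto.
    - assert (Hs := Hns (p2 k) s X H1 H2). unfold stuck in Hs.
      apply NNPP; intro Hno. apply Hs. split; auto. intros s' X' G1 G2 G3. apply Hno.
      exists (s', X'); cbn. split; [split; auto; intros x Hx; apply H2, G2; auto|]. auto. }
  set (seq := fix seq k := match k with 0 => (0, X0) | S k =>
    epsilon (inhabits (0, X0)) (fun q => ok q /\
      stronger A (fst q) (snd q) (fst (seq k)) (snd (seq k)) /\ req k q) end).
  assert (Hok : forall k, ok (seq k)).
  { induction k as [|k IH]; [split; cbn; auto|].
    apply (epsilon_spec (inhabits (0, X0)) _ (Hreq k (seq k) IH)). }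
  assert (Hst : forall k, stronger A (fst (seq (S k))) (snd (seq (S k))) (fst (seq k)) (snd (seq k)) /\
     req k (seq (S k))).
  { intro k. apply (epsilon_spec (inhabits (0, X0)) _ (Hreq k (seq k) (Hok k))). }
  set (sg := fun k => fst (seq k)). set (Xs := fun k => snd (seq k)).
  assert (Hdec : forall m z, m < n -> exists k, fpos m z (sg k) (Xs k) \/ fneg m z (sg k) (Xs k)).
  { intros m z Hm. exists (S (pr 0 (pr m z))). destruct (Hst (pr 0 (pr m z))) as [_ Hr].
    unfold req in Hr. repeat rewrite ?p1_pr, ?p2_pr in Hr. auto. }
  assert (Htr := gen_truth A sg Xs (fun k => proj1 (Hok k)) (fun k => proj1 (Hst k)) Hdec n (le_n n)).
  exists (gen sg). split; [|split].
  - apply gen_infinite. intro b. exists (S (pr 1 b)). destruct (Hst (pr 1 b)) as [_ Hr].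
    unfold req in Hr. rewrite p1_pr, p2_pr in Hr. auto.
  (* The sequence starts with 0, the code of the empty string, so every element of the generic set
     is taken from [A]. *)
  - intros x Hx. apply (gen_new A sg Xs) with (k := 0) in Hx; [tauto|intro k; apply Hst|].
    cbn. change (p1 0) with 0. lia.
  - intros e He. destruct (Hst (pr 2 e)) as [_ Hr]. unfold req in Hr.
    rewrite p1_pr, p2_pr in Hr. destruct Hr as [[x [Hx Hf]]|[x [Hx Hf]]].
    + apply Hx, He. apply (Htr (pr e x) (S (pr 2 e))); auto.
    + apply (Htr (pr e x) (S (pr 2 e))) in Hf. apply Hf, He; auto.
Qed.

(** * Requirements of the top level *)

Lemma re_differs Q : re (N n) Q -> exists x, (Q x /\ ~ B x) \/ (B x /\ ~ Q x).
Proof.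
  intro HQ. apply NNPP; intro Hno. apply HB. eapply sigma1_ext; [|apply re_sigma1, HQ].
  intro x. split; intro H; apply NNPP; intro H'; apply Hno; eauto.
Qed.

Definition hits (e s x D : nat) : Prop := reach (opn n (pr e x)) s (bit D).

Lemma hits_up e s x Y : up (hits e s x) Y <-> reach (opn n (pr e x)) s Y.
Proof. symmetry; apply reach_up. Qed.

Lemma hits_re e s : re (N n) (fun w => hits e s (p1 w) (p2 w)).
Proof.
  destruct (opn_re n (le_n n)) as [j Hj]. exists j.
  apply (sigma1_reach _ (fun w => opn n (pr e (p1 w))) (fun w => bit (p2 w)) (fun _ => s));
    [|cs|cs].
  apply (sigma1_app2 _ (opn n) (fun w => pr e (p1 (p1 w))) p2); auto; cs.
Qed.

Lemma re_section (R : nat -> nat -> Prop) x : re (N n) (fun w => R (p1 w) (p2 w)) -> re (N n) (R x).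
Proof.
  intros [j Hj]. exists j. apply (sigma1_app2 _ R (fun _ => x) (fun c => c)); auto; cs.
Qed.

(* Were the set of [x] for which every splitting of [X] meets one of the two open
   classes equal to [B], then [B] would be c.e. in the ideal. *)
Lemma splitting_dichotomy e s (R : nat -> nat -> Prop) X : inM (N n) X ->
  re (N n) (fun w => R (p1 w) (p2 w)) ->
  exists x,
    (~ B x /\ forall Z, reach (opn n (pr e x)) s (fun y => X y /\ Z y) \/
                       up (R x) (fun y => X y /\ ~ Z y)) \/
    (B x /\ exists Z, inM (N n) Z /\ fneg n (pr e x) s (fun y => X y /\ Z y) /\
                       ~ up (R x) (fun y => X y /\ ~ Z y)).
Proof.
  intros HX HR.
  destruct (re_common (N n) _ _ X (hits_re e s) HR HX) as [j [K0 [K1 KX]]].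
  destruct (re_differs (fun x => up (part (hits e s x) (R x)) X)) as [x [[H1 H2]|[H1 H2]]].
  - exists j. apply (sigma1_up _ (fun x => part (hits e s x) (R x)) (fun _ => X)); [|cs].
    apply sigma1_part; auto.
  - exists x; left. split; auto. rewrite part_spec in H1. intro Z.
    rewrite <- hits_up. apply H1.
  - exists x; right. split; auto.
    destruct (part_member (njump n emptyset) (N n) (hits e s x) (R x) X) as [Z [HZ [G0 G1]]]; auto.
    + apply re_section, hits_re.
    + apply re_section; auto.
    + exists Z. unfold fneg. rewrite <- hits_up. auto.
Qed.

(** Some open class includes [P n] but omits the part of [X] outside [A]; it plays the second class
    in the splitting question. The splitting by [A] can then only meet the first class, and a
    splitting whose second part avoids this open class leaves its first part large within [A]. *)
Lemma not_stuck_thin A e s X : ~ P n (fun x => X x /\ ~ A x) -> ~ stuck A e s X.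
Proof.
  intros Hthin [[HX HP] Hst]. assert (Hl := Hlarge n (le_n n)).
  destruct (large_def _ _ Hl) as [R [HR ER]].
  rewrite ER in Hthin. apply not_all_ex_not in Hthin as [q Hq].
  destruct (splitting_dichotomy e s (fun _ D => R (pr q D)) X) as
    [x [[Hb H]|[Hb [Z [HZ [G0 G1]]]]]]; auto.
  - destruct HR as [j HR]; exists j; cs.
  - destruct (H A) as [Hr|Hr]; [|auto].
    destruct (dense_pos A n (pr e x) s X) as [s' [X' [G1 [G2 G3]]]]; auto; [split; auto|].
    apply (Hst s' X'); auto. left; eauto.
  - assert (HXZ := inM_and _ _ _ _ (Hscott n (le_n n)) HX HZ).
    apply (Hst s (fun y => X y /\ Z y)).
    + split; auto. destruct (large_part _ _ Hl _ Z HP) as [H|H].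
      * eapply (large_up _ _ Hl); [|exact H]. cbn; tauto.
      * exfalso. apply G1. rewrite ER in H. eapply up_mono; [|apply (H q)]. cbn; tauto.
    + split; [apply ext_refl|tauto].
    + right. exists x; auto.
Qed.

(** The splitting question is asked for both requirements at once. If every splitting meets a class,
    the one by [A] gives a positive extension on one side, for some [x] outside [B]. Otherwise [x]
    is in [B], and each half of [X1] given by [Z] forces a negation for its side. A half is large
    for its side unless the second is large only within [A], which [not_stuck_thin] excludes. *)
Lemma not_stuck_opposite A e0 s0 X0 e1 s1 X1 : stuck A e0 s0 X0 -> (forall x, X1 x -> X0 x) ->
  ~ stuck (fun x => ~ A x) e1 s1 X1.
Proof.
  intros H0 HX Hs1. assert (Hl := Hlarge n (le_n n)).
  (* If [X1] is not large within [A], the thin case applies with the sides exchanged. *)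
  destruct (classic (P n (fun x => X1 x /\ A x))) as [HA|HA].
  2: { revert Hs1. apply not_stuck_thin. intro H. apply HA.
       eapply (large_up _ _ Hl); [|exact H]. cbn. intros x [? ?]; split; auto; apply NNPP; auto. }
  destruct H0 as [[HX0 HP0] Hst0], Hs1 as [[HX1 HP1] Hst1].
  destruct (splitting_dichotomy e0 s0 (hits e1 s1) X1) as
    [x [[Hb H]|[Hb [Z [HZ [G0 G1]]]]]]; auto; [apply hits_re| |].
  - destruct (H A) as [Hr|Hr].
    + destruct (dense_pos A n (pr e0 x) s0 X0) as [s' [X' [G1 [G2 G3]]]]; auto.
      * split; auto.
      * eapply reach_mono; [|exact Hr]. cbn. intros y [? ?]; auto.
      * apply (Hst0 s' X'); auto. left; eauto.
    + apply hits_up in Hr.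
      destruct (dense_pos (fun y => ~ A y) n (pr e1 x) s1 X1) as [s' [X' [G1 [G2 G3]]]]; auto.
      * split; auto.
      * apply (Hst1 s' X'); auto. left; eauto.
  - rewrite hits_up in G1.
    assert (HZ0 := inM_and _ _ _ _ (Hscott n (le_n n)) HX1 HZ).
    assert (HZ1 := inM_diff _ _ _ _ (Hscott n (le_n n)) HX1 HZ).
    destruct (classic (P n (fun y => (X1 y /\ ~ Z y) /\ ~ A y))) as [K1|K1].
    + apply (Hst1 s1 (fun y => X1 y /\ ~ Z y)).
      * split; auto.
      * split; [apply ext_refl|tauto].
      * right. exists x; auto.
    + destruct (classic (P n (fun y => (X1 y /\ ~ Z y) /\ A y))) as [K2|K2].
      * apply (not_stuck_thin A e0 s0 (fun y => X1 y /\ ~ Z y)); auto.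
        split; [split; auto|]. intros s' X' Hc Hle. apply Hst0; auto.
        eapply stronger_trans; [exact Hle|]. split; [apply ext_refl|].
        cbn. intros y [? ?]; auto.
      * apply (Hst0 s0 (fun y => X1 y /\ Z y)).
        -- split; auto. destruct (large_part _ _ Hl _ Z HA) as [H|H].
           ++ eapply (large_up _ _ Hl); [|exact H]. cbn; tauto.
           ++ destruct K2. eapply (large_up _ _ Hl); [|exact H]. cbn; tauto.
        -- split; [apply ext_refl|]. cbn. intros y [? ?]; auto.
        -- right. exists x; auto.
Qed.

(** A stuck condition for [A] gives a reservoir below which the complement is never stuck. Without
    one, [A] is used if it is large; otherwise all conditions for the complement are thin. *)
Theorem avoiding_subset A : exists G, infinite G /\
  ((forall x, G x -> A x) \/ (forall x, G x -> ~ A x)) /\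
  forall e, ~ forall x, B x <-> Sat n W (pr e x) G.
Proof.
  assert (Hl := Hlarge n (le_n n)).
  assert (Hfull := inM_full _ _ (Hscott n (le_n n))).
  destruct (classic (exists e s X, stuck A e s X)) as [[e [s [X Hs]]]|Hno].
  - destruct (generic_exists (fun x => ~ A x) X) as [G [G1 [G2 G3]]].
    + split; [apply Hs|]. apply NNPP; intro H. apply (not_stuck_thin A e s X); auto.
    + intros e' s' X' _ HX. eapply not_stuck_opposite; eauto.
    + exists G; auto.
  - destruct (classic (P n (fun x => True /\ A x))) as [HA|HA].
    + destruct (generic_exists A (fun _ => True)) as [G [G1 [G2 G3]]].
      * split; auto.
      * intros e s X _ _ Hs. apply Hno; eauto.
      * exists G; auto.
    + destruct (generic_exists (fun x => ~ A x) (fun _ => True)) as [G [G1 [G2 G3]]].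
      * split; auto. destruct (large_part _ _ Hl _ A (large_full _ _ Hl)); tauto.
      * intros e s X _ _. apply not_stuck_thin. intro H. apply HA.
        eapply (large_up _ _ Hl); [|exact H]. cbn. intros x [_ Hx]. split; auto. apply NNPP; auto.
      * exists G; auto.
Qed.
End Forcing.

(** * Construction of the tower and conclusion *)

Lemma avoiding_tower n B : ~ sigma1 (njump n emptyset) B ->
  exists (N I : nat -> nat -> Prop) (P : nat -> (nat -> Prop) -> Prop),
    (forall k, k <= n -> scott (njump k emptyset) (N k)) /\
    (forall k, k < n -> forall Q, sigma1 (N k) Q -> decid (njump (S k) emptyset) Q) /\
    (forall k, k <= n -> large (N k) (P k)) /\
    (forall k, k < n -> ultra (N k) (P k) (I k)) /\
    (forall k, k < n -> inM (N (S k)) (I k)) /\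
    (forall k, k < n -> P (S k) = next (N k) (I k)) /\
    ~ sigma1 (N n) B.
Proof.
  intro HB.
  destruct (avoiding_scott _ B HB) as [Nn [Hn1 Hn2]].
  (* The top Scott set avoids [B]; those below it are low. *)
  set (N := fun k => if Nat.eq_dec k n then Nn else
    proj1_sig (constructive_indefinite_description _ (low_scott (njump k emptyset)))).
  assert (HN : N n = Nn) by (unfold N; destruct (Nat.eq_dec n n); tauto).
  assert (Hlow : forall k, k < n -> scott (njump k emptyset) (N k) /\
    forall Q, sigma1 (N k) Q -> decid (njump (S k) emptyset) Q).
  { intros k Hk. unfold N. destruct (Nat.eq_dec k n); [lia|].
    destruct (constructive_indefinite_description _ _) as [M HM]. exact HM. }
  assert (Hsc : forall k, k <= n -> scott (njump k emptyset) (N k)).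
  { intros k Hk. destruct (Nat.eq_dec k n) as [->|]; [rewrite HN; auto|].
    apply Hlow; lia. }
  (* The ultrafilters are picked by [epsilon] before they are known to exist; [Hlg] then shows
     inductively that each class is large, which validates the choices. *)
  set (pickI := fun k Q => epsilon (inhabits (fun _ : nat => True))
    (fun J => inM (N (S k)) J /\ ultra (N k) Q J)).
  set (P := fix P k := match k with 0 => infinite | S k => next (N k) (pickI k (P k)) end).
  set (I := fun k => pickI k (P k)).
  assert (HI : forall k, k < n -> large (N k) (P k) ->
     inM (N (S k)) (I k) /\ ultra (N k) (P k) (I k)).
  { intros k Hk HP. unfold I, pickI.
    apply (epsilon_spec (inhabits (fun _ : nat => True)) (fun J => inM (N (S k)) J /\ ultra (N k) (P k) J)).
    apply (ultra_exists (njump k emptyset)); auto; [apply Hlow; auto|].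
    apply (Hsc (S k)); auto. }
  assert (Hlg : forall k, k <= n -> large (N k) (P k)).
  { induction k as [|k IH]; intro Hk; [apply large_infinite|].
    assert (HP := IH ltac:(lia)). destruct (HI k Hk HP) as [H1 H2].
    apply (next_large (njump k emptyset) (N k) (N (S k)) (P k)); auto.
    - apply Hsc; lia.
    - apply Hlow; auto.
    - apply (Hsc (S k)); auto. }
  exists N, I, P. split; [exact Hsc|]. split; [intros k Hk; apply Hlow; auto|].
  split; [exact Hlg|]. split; [intros k Hk; apply HI; auto; apply Hlg; lia|].
  split; [intros k Hk; apply HI; auto; apply Hlg; lia|]. split; [auto|].
  rewrite HN; auto.
Qed.

Lemma strong_avoidance n B A : ~ sigma1 (njump n emptyset) B ->
  exists H, infinite H /\ ((forall x, H x -> A x) \/ (forall x, H x -> ~ A x)) /\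
    ~ sigma1 (njump n H) B.
Proof.
  intro HB.
  destruct (avoiding_tower n B HB) as [N [I [P [H1 [H2 [H3 [H4 [H5 [H6 H7]]]]]]]]].
  destruct (Form_halts n) as [W [HW EW]].
  destruct (avoiding_subset n B N I P W H1 H2 H3 H4 H5 H6 H7 HW A) as [G [G1 [G2 G3]]].
  exists G. repeat split; auto. intros [e He]%sigma1_index. apply (G3 e). intro x.
  rewrite He, <- EW, p1_pr, p2_pr. tauto.
Qed.

Theorem theorem1 (n : nat) (B : nat -> Prop)
  (hB : ~ computable_in B (njump n emptyset)) :
  forall A : nat -> Prop,
    exists H : nat -> Prop,
      infinite H /\
      ((forall x, H x -> A x) \/ (forall x, H x -> ~ A x)) /\
      ~ computable_in B (njump n H).
Proof.
  intro A. rewrite computable_in_decid in hB.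
  (* By Post's theorem [B] and its complement are not both c.e. in the jump. Keeping either one from
     being c.e. in [njump n H] keeps [B] from being computable in it. *)
  assert (HB : ~ sigma1 (njump n emptyset) B \/ ~ sigma1 (njump n emptyset) (fun x => ~ B x)).
  { apply not_and_or. intros [H1 H2]. apply hB, post; auto. }
  destruct HB as [HB|HB]; destruct (strong_avoidance n _ A HB) as [H [H1 [H2 H3]]];
    exists H; (split; [auto|split; [auto|]]); rewrite computable_in_decid; intro Hd; apply H3.
  - apply sigma1_dec; auto.
  - apply sigma1_dec, decid_not; auto.
Qed.
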